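(* There is a sequence $(\mathcal A_\alpha)_{\alpha<\omega_1}$ of $C^*$-subalgebras of $\mathcal B(\ell_2)$ which are all isomorphic to $\mathcal K(\ell_2)$ and which are pairwise almost orthogonal, i.e. $AA'=^{\mathcal K}0$ for all $A\in\mathcal A_\alpha$, $A'\in\mathcal A_{\alpha'}$ for any $\alpha<\alpha'<\omega_1$, with the following property: given any two uncountable $X,Y\subseteq\omega_1$ and any choice of $A_\alpha\in\mathcal A_\alpha$ for $\alpha\in X$ and $B_\beta\in\mathcal A_\beta$ for $\beta\in Y$, there is no projection $P\in\mathcal B(\ell_2)$ satisfying $$PA_\alpha=^{\mathcal K}A_\alpha\ \text{ for all }\alpha\in X\quad\text{and}\quad PB_\beta=^{\mathcal K}0\ \text{ for all }\beta\in Y.$$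
   Context: $\mathcal B(\ell_2)$ and $\mathcal K(\ell_2)$ are the algebras of bounded, respectively compact, operators on the separable infinite-dimensional Hilbert space $\ell_2$. For $A,B\in\mathcal B(\ell_2)$, $A=^{\mathcal K}B$ means $A-B\in\mathcal K(\ell_2)$. Projections are self-adjoint idempotents; isomorphisms are $*$-isomorphisms. $\omega_1$ is the first uncountable ordinal.
   Formalization: The chosen elements A_α (α∈X) and B_β (β∈Y) are required to be nonzero; as literally stated, choosing all A_α = 0 and P = 0 would give a separating projection. *)

(* Defs.v *)
From HB Require Import structures.
From mathcomp Require Import all_boot all_order all_algebra.
From mathcomp Require Import all_classical all_reals all_analysis.
From mathcomp Require Import wochoice complex ring lra.

Set Implicit Arguments.
Unset Strict Implicit.
Unset Printing Implicit Defensive.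

Import Order.TTheory GRing.Theory Num.Theory.
Import numFieldNormedType.Exports.

Local Open Scope classical_set_scope.
Local Open Scope ring_scope.
Local Open Scope complex_scope.

Notation normc := Normc.normc.

Section Ell2.
Variable R : realType.
Implicit Types (x y : nat -> R[i]) (a : R[i]).

Definition sqsum x : R ^nat := series (fun n => normc (x n) ^+ 2).

Definition square_summable : {pred nat -> R[i]} := [pred x | `[< cvgn (sqsum x) >]].

Lemma square_summableP x : reflect (cvgn (sqsum x)) (x \in square_summable).
Proof. exact: asboolP. Qed.

Lemma normc_ge0 (z : R[i]) : 0 <= normc z.
Proof. by case: z => u v /=; exact: sqrtr_ge0. Qed.

Lemma sqsumZE a x : sqsum (a *: x) = normc a ^+ 2 *: sqsum x.
Proof.
rewrite /sqsum; apply/funext => n; rewrite /series/= [RHS]mulr_sumr.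
by apply: eq_bigr => i _; rewrite [(a *: x) i]/(a * x i) Normc.normcM exprMn.
Qed.

Lemma square_summable_closed : submod_closed square_summable.
Proof.
split.
  apply/square_summableP; rewrite (_ : sqsum _ = cst 0); first exact: is_cvg_cst.
  apply/funext => n; rewrite /sqsum /series /= big1// => i _.
by rewrite expr0n/= addr0 sqrtr0 expr0n.
move=> a x y /square_summableP xs /square_summableP ys; apply/square_summableP.
apply: (@series_le_cvg _ _
  ((2 * normc a ^+ 2) *: (fun n => normc (x n) ^+ 2)
   + 2 *: (fun n => normc (y n) ^+ 2))).
- by move=> n; exact: sqr_ge0.
- move=> n; apply: addr_ge0; apply: mulr_ge0; rewrite ?sqr_ge0//.
  by rewrite mulr_ge0// sqr_ge0.
- move=> n; have := le_normcD (a * x n) (y n); rewrite Normc.normcM => h.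
  have := normc_ge0 (a * x n + y n).
  change (0 <= normc (a * x n + y n) -> normc (a * x n + y n) ^+ 2 <=
    2 * normc a ^+ 2 * normc (x n) ^+ 2 + 2 * normc (y n) ^+ 2).
  set t := normc _ in h *; set u := normc a in h *; set v := normc (x n) in h *.
  set w := normc (y n) in h *; move=> t0.
  have uv0 : 0 <= u * v by rewrite mulr_ge0 ?normc_ge0.
  have w0 : 0 <= w by exact: normc_ge0.
  have : t ^+ 2 <= (u * v + w) ^+ 2 by rewrite ler_pXn2r// nnegrE addr_ge0.
  have := sqr_ge0 (u * v - w).
  nra.
by apply: is_cvg_seriesD; exact: is_cvg_seriesZ.
Qed.

HB.instance Definition _ :=
  GRing.isSubmodClosed.Build R[i] (nat -> R[i]) square_summable square_summable_closed.

Record ell2 := Ell2 {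
  ell2_val :> nat -> R[i];
  ell2_valP : ell2_val \in square_summable }.

HB.instance Definition _ := [isSub for ell2_val].
HB.instance Definition _ := [Choice of ell2 by <:].
HB.instance Definition _ := [SubChoice_isSubLmodule of ell2 by <:].


Definition ell2_norm (x : ell2) : R := Num.sqrt (limn (sqsum x)).

Lemma cvg_sqsum (x : ell2) : cvgn (sqsum x).
Proof. by case: x => x /= /square_summableP. Qed.

Lemma sqsum_le (x : ell2) n : sqsum x n <= limn (sqsum x).
Proof.
apply: nondecreasing_cvgn_le; last exact: cvg_sqsum.
by apply: nondecreasing_series => i _ _; exact: sqr_ge0.
Qed.

Lemma lim_sqsum_ge0 (x : ell2) : 0 <= limn (sqsum x).
Proof. by apply: le_trans (sqsum_le x 0); rewrite /sqsum /series/= big_geq. Qed.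

Lemma sqr_ell2_norm (x : ell2) : ell2_norm x ^+ 2 = limn (sqsum x).
Proof. by rewrite sqr_sqrtr// lim_sqsum_ge0. Qed.

Lemma ell2_norm_ge0 (x : ell2) : 0 <= ell2_norm x.
Proof. exact: sqrtr_ge0. Qed.

Lemma ell2_norm0_eq0 (x : ell2) : ell2_norm x = 0 -> x = 0.
Proof.
move=> x0; apply/val_inj/funext => n; apply: Normc.eq0_normc.
have := sqsum_le x n.+1; rewrite -sqr_ell2_norm x0 expr0n /sqsum /series/=.
rewrite big_nat_recr//= => h.
have s0 : 0 <= \sum_(0 <= k < n) normc (x k) ^+ 2.
  by apply: sumr_ge0 => i _; exact: sqr_ge0.
have t0 := normc_ge0 (x n).
by apply/eqP; rewrite -sqrf_eq0; apply/eqP; have := sqr_ge0 (normc (x n)); lra.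
Qed.

Lemma ell2_normZ a (x : ell2) : ell2_norm (a *: x) = normc a * ell2_norm x.
Proof.
rewrite /ell2_norm (_ : sqsum _ = normc a ^+ 2 *: sqsum x); last exact: sqsumZE.
rewrite limZl_tmp; last exact: cvg_sqsum.
by rewrite [_ *: _]/(_ * _) sqrtrM ?sqr_ge0// sqrtr_sqr ger0_norm ?normc_ge0.
Qed.

Lemma ell2_normD (x y : ell2) : ell2_norm (x + y) <= ell2_norm x + ell2_norm y.
Proof.
have [/ell2_norm0_eq0 ->|x0] := eqVneq (ell2_norm x) 0.
  by rewrite add0r ler_wpDl// ell2_norm_ge0.
have [/ell2_norm0_eq0 ->|y0] := eqVneq (ell2_norm y) 0.
  by rewrite addr0 ler_wpDr// ell2_norm_ge0.
set p := ell2_norm x; set q := ell2_norm y.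
have p0 : 0 < p by rewrite lt0r x0 ell2_norm_ge0.
have q0 : 0 < q by rewrite lt0r y0 ell2_norm_ge0.
rewrite -(@ler_pXn2r _ 2)// ?nnegrE ?ell2_norm_ge0//; last exact/ltW/addr_gt0.
pose f : R ^nat := fun n => normc (x n) ^+ 2.
pose g : R ^nat := fun n => normc (y n) ^+ 2.
have cf : cvgn (series f) by exact: cvg_sqsum.
have cg : cvgn (series g) by exact: cvg_sqsum.
pose c := (p + q) / p; pose d := (p + q) / q.
have lim_cd : limn (series (c *: f + d *: g)) = (p + q) ^+ 2.
  rewrite lim_seriesD; [|exact: is_cvg_seriesZ|exact: is_cvg_seriesZ].
  rewrite !lim_seriesZ// -[limn (series f)]sqr_ell2_norm -[limn (series g)]sqr_ell2_norm.
  rewrite -/p -/q -[LHS]/(c * p ^+ 2 + d * q ^+ 2) /c /d.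
  by field; rewrite x0 y0.
rewrite sqr_ell2_norm -lim_cd; apply: lim_series_le => [||n].
- exact: cvg_sqsum.
- by apply: is_cvg_seriesD; exact: is_cvg_seriesZ.
change (normc (x n + y n) ^+ 2 <= c * normc (x n) ^+ 2 + d * normc (y n) ^+ 2).
have := le_normcD (x n) (y n); have := normc_ge0 (x n + y n).
set t := normc _; set u := normc (x n); set v := normc (y n) => t0 tuv.
have u0 : 0 <= u by exact: normc_ge0.
have v0 : 0 <= v by exact: normc_ge0.
have h : t ^+ 2 <= (u + v) ^+ 2 by rewrite ler_pXn2r// nnegrE addr_ge0.
apply: (le_trans h); rewrite -subr_ge0.
rewrite (_ : _ - _ = (q * u - p * v) ^+ 2 / (p * q)); last first.
  by rewrite /c /d; field; rewrite x0 y0.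
by rewrite divr_ge0 ?sqr_ge0// mulr_ge0// ltW.
Qed.

(* Linear in the first argument; the limit in R[i] is taken componentwise. Both
   series converge absolutely by the Cauchy-Schwarz inequality. *)
Definition ell2_dot (x y : ell2) : R[i] :=
  limn (series (fun n => complex.Re (x n * (y n)^*))) +i*
  limn (series (fun n => complex.Im (x n * (y n)^*))).

Let normE (x : ell2) : R[i] := (ell2_norm x)%:C.

Let normED (x y : ell2) : normE (x + y) <= normE x + normE y.
Proof. by rewrite /normE -rmorphD/= lecR ell2_normD. Qed.

Let normEZ (a : R[i]) (x : ell2) : normE (a *: x) = `|a| * normE x.
Proof. by rewrite /normE ell2_normZ rmorphM. Qed.

Let normE0 (x : ell2) : normE x = 0 -> x = 0.
Proof. by move=> /complexI/ell2_norm0_eq0. Qed.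

(* A normed module over R[i] has an R[i]-valued norm. *)
HB.instance Definition _ := Lmodule_isNormed.Build R[i] ell2 normED normEZ normE0.

Lemma ell2_normE (x : ell2) : `|x| = (ell2_norm x)%:C.
Proof. by []. Qed.

End Ell2.

Section Operators.
Variable R : realType.
Local Notation H := (ell2 R).
Implicit Types (A B S T P : H -> H) (F G : set (H -> H)).

Definition bounded_operator T : Prop :=
  linear T /\ exists M : R[i], forall x, `|T x| <= M * `|x|.

Definition compact_operator T : Prop :=
  bounded_operator T /\ precompact (T @` [set x | `|x| <= 1]).

Definition eq_mod_compact A B : Prop := compact_operator (A - B).

Definition is_adjoint T S : Prop :=
  forall x y, ell2_dot (T x) y = ell2_dot x (S y).

Definition projection P : Prop :=
  [/\ bounded_operator P, P \o P = P & is_adjoint P P].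

Definition operator_norm_closed F : Prop :=
  forall T, bounded_operator T ->
    (forall e : R[i], 0 < e ->
       exists2 A, F A & forall x, `|T x - A x| <= e * `|x|) ->
    F T.

Record cstar_subalgebra F : Prop := CstarSubalgebra {
  cstar_bounded : forall A, F A -> bounded_operator A;
  cstar0 : F 0;
  cstar_linear : forall (a : R[i]) A B, F A -> F B -> F (a *: A + B);
  cstar_comp : forall A B, F A -> F B -> F (A \o B);
  cstar_adjoint : forall A, F A -> exists2 S, F S & is_adjoint A S;
  cstar_closed : operator_norm_closed F }.

(* Only the restriction of Phi to F matters. *)
Record star_isomorphism F G (Phi : (H -> H) -> (H -> H)) : Prop := StarIsomorphism {
  star_iso_bij : set_bij F G Phi;
  star_iso_linear : forall (a : R[i]) A B, F A -> F B ->
    Phi (a *: A + B) = a *: Phi A + Phi B;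
  star_iso_comp : forall A B, F A -> F B -> Phi (A \o B) = Phi A \o Phi B;
  star_iso_adjoint : forall A S, F A -> F S -> is_adjoint A S ->
    is_adjoint (Phi A) (Phi S) }.

Definition star_isomorphic F G : Prop := exists Phi, star_isomorphism F G Phi.

End Operators.

Arguments compact_operator {R}.

Notation "A =^K B" := (eq_mod_compact A B) (at level 70).

(* These properties determine the order type omega_1: a well-order which is
   uncountable but all of whose proper initial segments are countable. *)
Record is_omega1 d (W : orderType d) : Prop := IsOmega1 {
  omega1_well_order : well_order (<=%O : rel W);
  omega1_uncountable : ~ countable [set: W];
  omega1_segment : forall a : W, countable `]-oo, a[ }.

Lemma uncountable_cantor : ~ countable [set: nat -> bool].
Proof.
move=> /countable_injP[f finj].
pose d n := ~~ xget (fun=> false) [set x : nat -> bool | f x = n] n.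
have : xget (fun=> false) [set x : nat -> bool | f x = f d] = d.
  case: xgetP => [x _ /= fx|/(_ d)/= []//].
  by apply: (finj _ _ _ _ fx); rewrite inE.
set c := xget _ _ => cd; have : c (f d) = ~~ c (f d) by rewrite {1}cd.
by case: (c _).
Qed.

Section WellOrder.
Variables (T : eqType) (le : rel T).
Hypothesis le_wo : well_order le.

Let wo_all : wo_chain le predT. Proof. by move=> A _; exact: le_wo. Qed.

Lemma well_order_refl : reflexive le.
Proof. by move=> x; exact: (wo_chain_reflexive wo_all). Qed.

Lemma well_order_anti : antisymmetric le.
Proof. by move=> x y; exact: (wo_chain_antisymmetric wo_all). Qed.

Lemma well_order_total : total le.
Proof. by move=> x y; exact: (wo_chainW wo_all). Qed.

Lemma well_order_trans : transitive le.
Proof.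
move=> y x z xy yz; have [|m [[mA mmin] _]] := le_wo (A := pred3 x y z).
  by exists x; rewrite !inE eqxx.
have mx : le m x by apply: mmin; rewrite !inE eqxx.
have my : le m y by apply: mmin; rewrite !inE eqxx orbT.
have mz : le m z by apply: mmin; rewrite !inE eqxx !orbT.
move: mA; rewrite !inE => /or3P[] /eqP mE; subst m => //.
  by rewrite (_ : x = y)//; apply: well_order_anti; rewrite xy mx.
by rewrite -(_ : y = z) //; apply: well_order_anti; rewrite yz my.
Qed.

End WellOrder.

Lemma omega1_exists : exists (d : Order.disp_t) (W : orderType d), is_omega1 W.
Proof.
have [le le_wo] := well_ordering_principle (nat -> bool).
pose seg (x : nat -> bool) := [set y | le y x /\ y != x].
pose small : pred (nat -> bool) := fun x => countable (seg x).
pose W0 := {x | small x}.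
pose leW : rel W0 := fun x y => le (val x) (val y).
have leW_refl : reflexive leW by move=> x; exact: (well_order_refl le_wo).
have leW_anti : antisymmetric leW.
  by move=> x y /(well_order_anti le_wo)/val_inj.
have leW_trans : transitive leW by move=> y x z; exact: (well_order_trans le_wo).
have leW_total : total leW by move=> x y; exact: (well_order_total le_wo).
pose d := Order.Disp tt tt.
pose Wmix := Order.Le_isPOrder.Build d W0 leW_refl leW_anti leW_trans.
pose Wpo : porderType d := HB.pack W0 Wmix.
pose Wtot := Order.POrder_isTotal.Build d Wpo leW_total.
pose W : orderType d := HB.pack W0 Wpo Wtot.
exists d, W.
have itvW (x y : W) : x \in `]-oo, y[ -> seg (val (y : W0)) (val (x : W0)).
  by rewrite in_itv/= lt_def => /andP[yx xy]; split; rewrite // eq_sym.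
have segW a : countable (seg a) -> countable [set w : W0 | seg a (val w)].
  move=> /countable_injP[f finj]; apply/countable_injP; exists (f \o val).
  by move=> x y; rewrite !inE => sx sy /finj xy; apply/val_inj/xy; rewrite inE.
split.
- apply: (antisymmetric_well_order (R := leW)) => // A [a aA].
  pose B : {pred nat -> bool} := fun x => `[< exists2 w, w \in A & x = val w >].
  have [|_ [[/asboolP[m mA ->] mmin] _]] := le_wo B.
    by exists (val a); apply/asboolP; exists a.
  by exists m; split=> // w wA; apply: mmin; apply/asboolP; exists w.
- move=> /countable_injP[f finj]; apply: uncountable_cantor.
  have smallc : countable [set x | small x].
    apply/countable_injP.
    exists (fun x => if insub x is Some w then f (w : W0) else 0%N) => x y.
    rewrite !inE => sx sy; rewrite (insubT small sx) (insubT small sy).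
    by move=> /(finj _ _ (in_setT _) (in_setT _))[].
  apply: contrapT => Tunc.
  have [|z [[zS zmin] _]] := le_wo (fun x => ~~ small x).
    apply: contrapT => all_small; apply: Tunc.
    apply: sub_countable smallc; apply: subset_card_le => x _ /=.
    by apply: contrapT => /negP xS; apply: all_small; exists x.
  move/negP: (zS); apply; apply: sub_countable smallc; apply: subset_card_le.
  move=> y [yz ynz] /=; apply: contrapT => /negP yS; move/eqP: ynz; apply.
  by apply: (well_order_anti le_wo); rewrite yz zmin.
- move=> a; apply: sub_countable (segW _ (valP (a : W0))).
  by apply: subset_card_le => w; exact: itvW.
Qed.

(* Main.v *)
(* Each algebra is a copy [T |-> T (x) 1] of the compact operators carried by
   basis vectors: an injection [phi a] of [nat * nat] into [nat] identifies part
   of ell2 with ell2 (x) ell2, whose columns [m |-> (e_(phi a m i))_i] are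
   orthonormal.  Distinct [phi a], [phi b] have disjoint columns from some point
   on, so that products of elements of distinct algebras are compact.  As for a
   Luzin gap, the recursion on [a] makes column [m] of [a] meet column [m] of an
   earlier [b] in exactly one vector, e_(phi a m i) = e_(phi b m j), for all [i],
   [j] and, given [n], for all but finitely many [b < a] with some [m >= n].
   If [P] separated uncountable families, then, A_a being nonzero, A_a sends the
   basis vectors of some row to copies v_m of one vector v in the columns
   of [a], with v_i <> 0 and P v_m - v_m -> 0; similarly B_b gives w_m with
   w_j <> 0 and P w_m -> 0.  All parameters, rates of convergence included, can
   be made constant on uncountable subfamilies, and then
   <v_m, w_m> = v_i (w_j)^* is bounded below at a meeting column although it is
   at most |<v_m - P v_m, w_m>| + |<v_m, P w_m>|, which is small. *)
Require Import Defs.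
From mathcomp Require Import all_boot all_order all_algebra.
From mathcomp Require Import all_classical all_reals all_analysis.
From mathcomp Require Import wochoice complex ring lra zify.

Set Implicit Arguments.
Unset Strict Implicit.
Unset Printing Implicit Defensive.

Import Order.TTheory GRing.Theory Num.Theory.
Import numFieldNormedType.Exports.

Local Open Scope classical_set_scope.

(** * Injections with the Luzin property *)

Local Arguments CodeSeq.code : simpl never.

Lemma code_inj : injective CodeSeq.code.
Proof. exact: can_inj CodeSeq.codeK. Qed.

Section Luzin.
Variables (d : Order.disp_t) (W : orderType d).
Hypothesis Womega1 : is_omega1 W.

Lemma omega1_wf : well_founded (fun a b : W => (a < b)%O).
Proof.
move=> a; apply: contrapT => na.
have [|m [[/asboolP mA mmin] _]] := omega1_well_order Womega1 
  (A := fun x : W => `[< ~ Acc (fun a b : W => (a < b)%O) x >]).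
  by exists a; apply/asboolP.
apply: mA; constructor => y ym; apply: contrapT => ny.
have /= := mmin y; rewrite unfold_in => /(_ (introT (asboolP _) ny)).
by rewrite leNgt ym.
Qed.

(** [luzin_enc a] numbers the countable segment below [a], injectively on that segment only. Stage
    [a] of the recursion ranks the earlier points by these numbers. *)
Definition luzin_enc : W -> W -> nat :=
  projT1 (choice (fun a => elimT (countable_injP _) (omega1_segment Womega1 a))).

Lemma luzin_enc_inj a b c : (b < a)%O -> (c < a)%O ->
  luzin_enc a b = luzin_enc a c -> b = c.
Proof.
rewrite /luzin_enc; case: choice => f /= fP ba ca.
by apply: fP; rewrite inE/= in_itv/=.
Qed.

(** Only finitely many [b < a] have a number below [k], so their thresholds have a maximum. *)
Lemma segment_bound a (Q : W -> nat -> Prop) k :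
  (forall b, (b < a)%O -> exists N, forall m, (N <= m)%N -> Q b m) ->
  exists N, forall m, (N <= m)%N -> forall b, (b < a)%O ->
    (luzin_enc a b < k)%N -> Q b m.
Proof.
move=> QN; elim: k => [|k [N NP]]; first by exists 0%N.
have [[b [ba bk]]|nb] := pselect (exists b, (b < a)%O /\ luzin_enc a b = k).
  have [N' N'P] := QN _ ba; exists (maxn N N') => m; rewrite geq_max => /andP[Nm N'm] c ca.
  rewrite ltnS leq_eqVlt => /orP[/eqP ck|]; last exact: NP.
  by rewrite (@luzin_enc_inj a c b)// ?bk//; exact: N'P.
exists N => m Nm c ca; rewrite ltnS leq_eqVlt => /orP[/eqP ck|]; last exact: NP.
by exfalso; apply: nb; exists c.
Qed.

(* A point of the family assigns to each [m] a block number and an injection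
   [bool * nat -> nat]; only the values at [(true, _)] are used, those at
   [(false, _)] keep infinitely many basis vectors of the block in reserve. *)
Definition luzin_point := nat -> nat * (bool * nat -> nat).

(** All positions except [(true, i)] are filled from the reserve [F (false, _)]: its odd indices
    give the new [true] part and its even ones the new reserve. Thus one vector of the old [true]
    part is shared and grafting can be repeated. *)
Definition graft (F : bool * nat -> nat) (i j : nat) : bool * nat -> nat :=
  fun x => if x == (true, i) then F (true, j) else F (false, x.1 + x.2.*2)%N.

Lemma graft_inj F i j : injective F -> injective (graft F i j).
Proof.
move=> Finj [b x] [c y]; rewrite /graft; case: eqP => [->|_]; case: eqP => [->|_] //;
  move=> /Finj[] //=.
by case: b; case: c => /= h; congr (_, _); lia.
Qed.

Lemma graft_meet F i j x y : injective F ->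
  graft F i j (true, x) = F (true, y) -> x = i /\ y = j.
Proof. by move=> Finj; rewrite /graft; case: eqP => [[->]|_] /Finj[]. Qed.

(** * One stage of the recursion *)

Section Step.
Variables (a : W) (h : W -> luzin_point).

(** The recursion picks a threshold from this set by [xget]; that one exists is known only by
    induction, through [luzin_sep_ex]. *)
Definition luzin_sep b : set nat := [set N | forall m, (N <= m)%N -> forall c,
  (c < a)%O -> (luzin_enc a c < luzin_enc a b)%N -> (h b m).1 <> (h c m).1].

(** [(b, (i, j))] demands that column [m] of [a] meet column [m] of [b] in positions [i] and [j].
    The bounds on [i] and [j] leave finitely many demands per [b], which keeps [a] and [b] almost
    disjoint, and still admit a given [(i, j)] for all but finitely many [b]. A code exceeds its
    entries, so coding the threshold into [m] places [m] beyond it. *)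
Definition luzin_active m (z : W * (nat * nat)) : Prop :=
  [/\ (z.1 < a)%O, (z.2.1 <= luzin_enc a z.1)%N, (z.2.2 <= luzin_enc a z.1)%N &
      m = CodeSeq.code [:: luzin_enc a z.1; z.2.1; z.2.2; xget 0%N (luzin_sep z.1)]].

Definition luzin_new m : set nat := [set x | forall b,
  (b < a)%O -> (luzin_enc a b <= m)%N -> (h b m).1 <> x].

Definition luzin_step : luzin_point := fun m =>
  if pselect (exists z, luzin_active m z) is left e then
    let z := sval (cid e) in
    ((h z.1 m).1, graft (h z.1 m).2 z.2.1 z.2.2)
  else (xget 0%N (luzin_new m), pickle).

Lemma luzin_active_uniq m z z' : luzin_active m z -> luzin_active m z' -> z = z'.
Proof.
case: z z' => [b [i j]] [b' [i' j']] [/= ba _ _ ->] [/= b'a _ _].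
move=> /code_inj[eb -> -> _].
by rewrite (luzin_enc_inj ba b'a eb).
Qed.

Lemma luzin_step_active m z : luzin_active m z ->
  luzin_step m = ((h z.1 m).1, graft (h z.1 m).2 z.2.1 z.2.2).
Proof.
move=> az; rewrite /luzin_step; case: pselect => [e|]; last by case; exists z.
by case: (cid e) => z' /= /luzin_active_uniq/(_ az) ->.
Qed.

Lemma luzin_step_idle m : ~ (exists z, luzin_active m z) ->
  luzin_step m = (xget 0%N (luzin_new m), pickle).
Proof. by move=> na; rewrite /luzin_step; case: pselect. Qed.

(** Only finitely many block numbers are forbidden; [segment_bound] is applied with the block number
    in the role of the column index. *)
Lemma luzin_newP m : luzin_new m (xget 0%N (luzin_new m)).
Proof.
have [|N NP] := @segment_bound a (fun b x => (h b m).1 <> x) m.+1.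
  by move=> b _; exists (h b m).1.+1 => x /[swap] <-; rewrite ltnn.
by apply: (@xgetPex _ 0%N (luzin_new m)); exists N => b ba bm; exact: NP.
Qed.

End Step.

(** Stage [a] reads earlier points only, so the default value that [luzin_family] puts at the other
    points has no effect. *)
Lemma luzin_step_ext a h h' : (forall b, (b < a)%O -> h b = h' b) ->
  luzin_step a h = luzin_step a h'.
Proof.
move=> hh'; have sepE b : (b < a)%O -> luzin_sep a h b = luzin_sep a h' b.
  move=> ba; apply/seteqP; split=> N NP m Nm c ca cb.
    by rewrite -hh'// -hh'//; exact: NP.
  by rewrite hh'// hh'//; exact: NP.
have actE m z : luzin_active a h m z -> luzin_active a h' m z.
  by move=> [za ? ? mE]; split => //; rewrite -sepE.
have actE' m z : luzin_active a h' m z -> luzin_active a h m z.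
  by move=> [za ? ? mE]; split => //; rewrite sepE.
have newE m : luzin_new a h m = luzin_new a h' m.
  by apply/seteqP; split=> x xP b ba bm; [rewrite -hh'//|rewrite hh'//]; exact: xP.
apply/funext => m; have [[z az]|na] := pselect (exists z, luzin_active a h m z).
  rewrite (luzin_step_active az) (luzin_step_active (actE _ _ az)).
  by case: az => za _ _ _; rewrite hh'.
by rewrite !luzin_step_idle// ?newE// => -[z /actE' az]; apply: na; exists z.
Qed.

Definition luzin_family : W -> luzin_point := Fix omega1_wf (fun _ => luzin_point)
  (fun a rec => luzin_step a (fun b =>
     if pselect (b < a)%O is left ba then rec b ba else fun=> (0%N, pickle))).

Local Notation g := luzin_family.

Lemma luzin_familyE a : g a = luzin_step a g.
Proof.
rewrite {1}/luzin_family Fix_eq.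
  by apply: luzin_step_ext => b ba; case: pselect.
move=> x f f' ff'; congr luzin_step; apply/funext => b.
by case: pselect.
Qed.

Lemma luzin_family_inj a m : injective (g a m).2.
Proof.
elim/(well_founded_ind omega1_wf): a m => a IH m.
rewrite luzin_familyE; have [[z az]|na] := pselect (exists z, luzin_active a g m z).
  by rewrite (luzin_step_active az); apply: graft_inj; apply: IH; case: az.
by rewrite luzin_step_idle//; exact: (pcan_inj pickleK).
Qed.

Lemma code_gt s k : k \in s -> (k < CodeSeq.code s)%N.
Proof.
have /allP := CodeSeq.gtn_decode (CodeSeq.code s).
by rewrite CodeSeq.codeK => h /h.
Qed.

Lemma luzin_sep_ex a (b : W) : (b < a)%O ->
  (forall b c, (b < a)%O -> (c < a)%O -> b <> c ->
    exists N, forall m, (N <= m)%N -> (g b m).1 <> (g c m).1) ->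
  luzin_sep a g b (xget 0%N (luzin_sep a g b)).
Proof.
move=> ba IH; apply: (@xgetPex _ 0%N (luzin_sep a g b)).
have [|N NP] := @segment_bound a (fun c m => c <> b -> (g b m).1 <> (g c m).1) (luzin_enc a b).
  move=> c ca; have [->|/eqP cb] := eqVneq c b; first by exists 0%N.
  by have [N NP] := IH _ _ ba ca (nesym cb); exists N => m Nm _; exact: NP.
exists N => m Nm c ca cb; apply: NP => // E; move: cb; by rewrite E ltnn.
Qed.

(** By induction on the later point [a]. An idle column of [a] avoids the block of [b] as soon as
    [m] reaches the number of [b]. An active column takes its block from some [c]: the case [c = b]
    occurs for finitely many [m], only finitely many [c] have a smaller number than [b], and a [c]
    with a larger number is active only beyond its threshold against [b]. *)
Lemma luzin_family_ad a b : a <> b ->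
  exists N, forall m, (N <= m)%N -> (g a m).1 <> (g b m).1.
Proof.
wlog ba : a b / (b < a)%O => [hwlog|].
  move=> ab; have /eqP := ab; rewrite neq_lt => /orP[ltab|ltba]; last exact: (hwlog _ _ ltba).
  by have [N NP] := hwlog _ _ ltab (nesym ab); exists N => m /NP /nesym.
elim/(well_founded_ind omega1_wf): a b ba => a IH b ba _.
have {}IH b' c : (b' < a)%O -> (c < a)%O -> b' <> c ->
    exists N, forall m, (N <= m)%N -> (g b' m).1 <> (g c m).1.
  move=> b'a ca b'c; have /eqP := b'c; rewrite neq_lt => /orP[ltbc|ltcb]; last exact: IH.
  by have [N NP] := IH c ca _ ltbc (nesym b'c); exists N => m /NP /nesym.
pose K := luzin_enc a b.
have [|N NP] := @segment_bound a (fun c m => c <> b -> (g c m).1 <> (g b m).1) K.+1.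
  move=> c ca; have [->|/eqP cb] := eqVneq c b; first by exists 0%N.
  by have [N NP] := IH _ _ ca ba cb; exists N => m Nm _; exact: NP.
pose B := xget 0%N (luzin_sep a g b).
(* [M] bounds all columns at which [b] itself is active. *)
pose M := \max_(i < K.+1) \max_(j < K.+1) (CodeSeq.code [:: K; i : nat; j : nat; B]).
exists (maxn N (maxn K M.+1)) => m; rewrite !geq_max => /and3P[Nm Km Mm].
rewrite luzin_familyE; have [[[c [i j]] az]|na] := pselect (exists z, luzin_active a g m z).
  rewrite (luzin_step_active az)/=; case: az => /= ca ic jc mE.
  have [E|/eqP cb] := eqVneq c b.
    subst c; exfalso; move: Mm; rewrite mE -/K -/B ltnNge => /negP; apply.
    rewrite /M; have iK : (i < K.+1)%N by [].
    have jK : (j < K.+1)%N by [].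
    apply: leq_trans (leq_bigmax (Ordinal iK)) => /=.
    exact: leq_trans (leq_bigmax (Ordinal jK)).
  have [cK|Kc] := leqP (luzin_enc a c) K; first exact: NP.
  apply: (luzin_sep_ex ca IH) => //; rewrite mE; apply: ltnW; apply: code_gt.
  by rewrite !inE eqxx !orbT.
rewrite luzin_step_idle//=; apply: nesym; exact: luzin_newP.
Qed.

(** Every [b] whose number is at least [n], [i] and [j] makes the demand [(i, j)], at a column that
    is a code of its number and hence exceeds [n]. *)
Lemma luzin_family_meet a i j n : finite_set [set b | (b < a)%O /\
  ~ exists2 m, (n <= m)%N & (g a m).1 = (g b m).1 /\
     (g a m).2 = graft (g b m).2 i j].
Proof.
pose K := maxn n (maxn i j).
have finK : finite_set [set b | (b < a)%O /\ (luzin_enc a b < K)%N].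
  rewrite -(eq_finite_set (@inj_card_eq _ _ _ (luzin_enc a) _)); last first.
    by move=> b c; rewrite !inE => -[ba _] [ca _]; exact: luzin_enc_inj.
  by apply: sub_finite_set (finite_II K) => _ [b [_ bK] <-].
apply: sub_finite_set finK => b [ba nex]; split=> //; rewrite ltnNge; apply/negP.
rewrite !geq_max => /and3P[nb ib jb]; apply: nex.
pose m := CodeSeq.code [:: luzin_enc a b; i; j; xget 0%N (luzin_sep a g b)].
exists m; first by apply: leq_trans nb _; apply: ltnW; apply: code_gt; rewrite inE eqxx.
by rewrite luzin_familyE (@luzin_step_active _ _ _ (b, (i, j))).
Qed.

Theorem luzin_injections : exists phi : W -> nat -> nat -> nat,
  [/\ forall a b m k i j, phi a m i = phi b k j -> m = k,
      forall a m i, (m <= phi a m i)%N /\ injective (phi a m),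
      forall a b, a <> b -> exists N, forall m k i j, (N <= m)%N -> phi a m i <> phi b k j
    & forall a i j n, finite_set [set b | (b < a)%O /\
        ~ exists2 m, (n <= m)%N & phi a m i = phi b m j /\
          forall x y, phi a m x = phi b m y -> x = i /\ y = j]].
Proof.
(* The first two entries separate distinct columns and distinct blocks; inside a common block only
   the injections decide. *)
pose phi a m i := CodeSeq.code [:: m; (g a m).1; (g a m).2 (true, i)].
exists phi; split.
- by move=> a b m k i j /code_inj[].
- move=> a m i; split; first by apply/ltnW/code_gt; rewrite inE eqxx.
  by move=> x y /code_inj[] /luzin_family_inj[].
- move=> a b /luzin_family_ad[N NP]; exists N => m k i j Nm /code_inj[<- E _].
  exact: (NP m).
- move=> a i j n; apply: sub_finite_set (luzin_family_meet a i j n) => b [ba nex].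
  split=> // -[m nm [E1 E2]]; apply: nex; exists m => //; split.
    by rewrite /phi E1 E2 /graft eqxx.
  by move=> x y /code_inj[_]; rewrite E2 => /graft_meet; apply; exact: luzin_family_inj.
Qed.

End Luzin.

Local Open Scope ring_scope.
Local Open Scope complex_scope.

(** * The Hilbert space [ell2] *)

Local Arguments ell2_dot : simpl never.
Local Arguments ell2_val : simpl never.

Section ComplexNumbers.
Variable R : realType.
Implicit Types z w : R[i].

Lemma normcE z : `|z| = (normc z)%:C.
Proof. by []. Qed.

Lemma conjcD z w : conjc (z + w) = conjc z + conjc w.
Proof. exact: rmorphD. Qed.

Lemma conjcM z w : conjc (z * w) = conjc z * conjc w.
Proof. exact: rmorphM. Qed.

Lemma conjcN z : conjc (- z) = - conjc z.
Proof. exact: rmorphN. Qed.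

Lemma realcB (r s : R) : (r - s)%:C = r%:C - s%:C :> R[i].
Proof. exact: rmorphB. Qed.

Lemma realcM (r s : R) : (r * s)%:C = r%:C * s%:C :> R[i].
Proof. exact: rmorphM. Qed.

Lemma normc_conj z : normc (conjc z) = normc z.
Proof. by case: z => a b /=; rewrite sqrrN. Qed.

Lemma mulc_conj z : z * conjc z = (normc z ^+ 2)%:C.
Proof. by rewrite -sqr_normc normcE rmorphXn. Qed.

Lemma normcC (r : R) : normc r%:C = `|r|.
Proof. by rewrite /= expr0n/= addr0 sqrtr_sqr. Qed.

Lemma normc_Re z : `|complex.Re z| <= normc z.
Proof. by have := normc_ge_Re z; rewrite normcE lecR. Qed.

Lemma normc_Im z : `|complex.Im z| <= normc z.
Proof.
case: z => a b /=; rewrite -sqrtr_sqr ler_wsqrtr// lerDr; exact: sqr_ge0.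
Qed.

Lemma normc_le_ReIm z : normc z <= `|complex.Re z| + `|complex.Im z|.
Proof.
case: z => a b /=; rewrite -[leRHS]ger0_norm ?addr_ge0// -sqrtr_sqr ler_wsqrtr//.
rewrite sqrrD !real_normK ?num_real//.
have : 0 <= `|a| * `|b| by rewrite mulr_ge0.
lra.
Qed.

(** Componentwise, to match the limits that define [ell2_dot]. *)
Definition cvgc (u : nat -> R[i]) (l : R[i]) : Prop :=
  (fun n => complex.Re (u n)) @ \oo --> complex.Re l /\
  (fun n => complex.Im (u n)) @ \oo --> complex.Im l.

Lemma cvgc_uniq u l l' : cvgc u l -> cvgc u l' -> l = l'.
Proof.
move=> [ul1 ul2] [ul'1 ul'2]; apply/eqP; rewrite eq_complex; apply/andP; split; apply/eqP.
  exact: (cvg_unique _ ul1 ul'1).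
exact: (cvg_unique _ ul2 ul'2).
Qed.

Lemma cvgcD u v l l' : cvgc u l -> cvgc v l' -> cvgc (fun n => u n + v n) (l + l').
Proof.
move=> [u1 u2] [v1 v2]; split; rewrite ?raddfD/=;
  under eq_fun do rewrite raddfD/=; exact: cvgD.
Qed.

Lemma cvgcZ a u l : cvgc u l -> cvgc (fun n => a * u n) (a * l).
Proof.
case: a l => a b [c e] [/= u1 u2]; split => /=.
  have -> : (fun n => complex.Re ((a +i* b) * u n)) =
    (fun n => a * complex.Re (u n) - b * complex.Im (u n)).
    by apply/funext => n; case: (u n).
  by apply: cvgB; apply: cvgMr.
have -> : (fun n => complex.Im ((a +i* b) * u n)) =
    (fun n => a * complex.Im (u n) + b * complex.Re (u n)).
  by apply/funext => n; case: (u n).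
by apply: cvgD; apply: cvgMr.
Qed.

Lemma cvgc_conj u l : cvgc u l -> cvgc (fun n => conjc (u n)) (conjc l).
Proof.
case: l => a b [/= u1 u2]; split => /=.
  by have -> : (fun n => complex.Re (conjc (u n))) = (fun n => complex.Re (u n));
    first by apply/funext => n; case: (u n).
have -> : (fun n => complex.Im (conjc (u n))) = (fun n => - complex.Im (u n)).
  by apply/funext => n; case: (u n).
exact: cvgN.
Qed.

Lemma cvgc_near_cst u l N : (forall n, (N <= n)%N -> u n = l) -> cvgc u l.
Proof.
by move=> ul; split; apply: cvg_near_cst; exists N => // n /ul ->.
Qed.

End ComplexNumbers.

Section Ell2Theory.
Variable R : realType.
Local Notation H := (ell2 R).
Local Notation "''N' x" := (ell2_norm x) (at level 10).
Implicit Types (x y z : H) (c : R[i]).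

Lemma ell2P x y : (forall n, x n = y n) -> x = y.
Proof. by move=> xy; apply/val_inj/funext. Qed.

Lemma ell2DE x y n : (x + y) n = x n + y n. Proof. by []. Qed.
Lemma ell2NE x n : (- x) n = - x n. Proof. by []. Qed.
Lemma ell2BE x y n : (x - y) n = x n - y n. Proof. by []. Qed.
Lemma ell2ZE c x n : (c *: x) n = c * x n. Proof. by []. Qed.

Lemma ell2_sumE (I : Type) (s : seq I) (P : pred I) (F : I -> H) n :
  (\sum_(i <- s | P i) F i) n = \sum_(i <- s | P i) F i n.
Proof. by elim/big_rec2: _ => // i u v _ <-. Qed.

(** A sequence that is not square summable goes to 0, so that an operator can be defined before its
    boundedness is known. *)
Definition to_ell2 (x : nat -> R[i]) : H := insubd (0 : H) x.

Lemma square_summable_bound (x : nat -> R[i]) (M : R) :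
  (forall n, sqsum x n <= M) -> x \in @square_summable R.
Proof.
move=> xM; apply/square_summableP; apply: nondecreasing_is_cvgn.
  by apply: nondecreasing_series => i _ _; exact: sqr_ge0.
by exists M => _ [n _ <-].
Qed.

Lemma to_ell2E (x : nat -> R[i]) n : x \in @square_summable R -> to_ell2 x n = x n.
Proof. by move=> xs; rewrite /to_ell2 /insubd insubT. Qed.

Lemma norm_sqsum_le x (M : R) : (forall n, sqsum x n <= M ^+ 2) -> 0 <= M -> 'N x <= M.
Proof.
move=> xM M0; rewrite -(@ler_pXn2r _ 2)// ?nnegrE ?ell2_norm_ge0// sqr_ell2_norm.
apply: limr_le; first exact: cvg_sqsum.
by apply: nearW.
Qed.

Lemma sqsum_norm x n : sqsum x n <= 'N x ^+ 2.
Proof. by rewrite sqr_ell2_norm; exact: sqsum_le. Qed.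

Lemma norm0 : 'N (0 : H) = 0.
Proof.
by rewrite -(scale0r (0 : H)) ell2_normZ Normc.normc0 mul0r.
Qed.

Lemma ell2_normN x : 'N (- x) = 'N x.
Proof. by rewrite -scaleN1r ell2_normZ normcN Normc.normc1 mul1r. Qed.

Lemma ell2_normB x y : 'N (x - y) <= 'N x + 'N y.
Proof. by rewrite -(ell2_normN y) ell2_normD. Qed.

Lemma norm_le_coord x y : (forall n, normc (x n) <= normc (y n)) -> 'N x <= 'N y.
Proof.
move=> xy; apply: norm_sqsum_le (ell2_norm_ge0 y) => n.
apply: le_trans (sqsum_norm y n); apply: ler_sum => i _.
by rewrite ler_pXn2r ?nnegrE ?normc_ge0.
Qed.

Lemma coord_le_norm x n : normc (x n) <= 'N x.
Proof.
rewrite -(@ler_pXn2r _ 2) ?nnegrE ?ell2_norm_ge0 ?normc_ge0//.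
apply: le_trans (sqsum_norm x n.+1); rewrite /sqsum /series/= big_nat_recr//= lerDr.
by apply: sumr_ge0 => i _; exact: sqr_ge0.
Qed.

Lemma dot_cvg x y : cvgc (fun n => \sum_(0 <= k < n) x k * conjc (y k)) (ell2_dot x y).
Proof.
have bnd k : normc (x k * conjc (y k)) <= normc (x k) ^+ 2 + normc (y k) ^+ 2.
  rewrite Normc.normcM normc_conj.
  have := sqr_ge0 (normc (x k) - normc (y k)); have := normc_ge0 (x k).
  have := normc_ge0 (y k); nra.
have cv : cvgn (series (fun k => normc (x k) ^+ 2 + normc (y k) ^+ 2)).
  by apply: is_cvg_seriesD; exact: cvg_sqsum.
have key (f : R[i] -> R) : (forall w : R[i], `|f w| <= normc w) ->
    cvgn (series (fun k => f (x k * conjc (y k)))).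
  move=> fle; apply: normed_cvg; apply: series_le_cvg cv => [n|n|n] //=.
    by rewrite addr_ge0// sqr_ge0.
  exact: le_trans (fle _) (bnd n).
split => /=.
  rewrite (_ : (fun n => _) = series (fun n => complex.Re (x n * conjc (y n)))).
    exact: key (@normc_Re R).
  by apply/funext => n; rewrite raddf_sum.
rewrite (_ : (fun n => _) = series (fun n => complex.Im (x n * conjc (y n)))).
  exact: key (@normc_Im R).
by apply/funext => n; rewrite raddf_sum.
Qed.

Lemma dotDl x y z : ell2_dot (x + y) z = ell2_dot x z + ell2_dot y z.
Proof.
apply: cvgc_uniq (dot_cvg _ _) _; move: (cvgcD (dot_cvg x z) (dot_cvg y z)).
congr cvgc; apply/funext => n; rewrite -big_split/=; apply: eq_bigr => k _.
exact/esym/mulrDl.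
Qed.

Lemma dotZl c x y : ell2_dot (c *: x) y = c * ell2_dot x y.
Proof.
apply: cvgc_uniq (dot_cvg _ _) _; move: (cvgcZ c (dot_cvg x y)).
congr cvgc; apply/funext => n; rewrite mulr_sumr; apply: eq_bigr => k _.
exact: mulrA.
Qed.

Lemma dotC x y : ell2_dot y x = conjc (ell2_dot x y).
Proof.
apply: cvgc_uniq (dot_cvg _ _) _; move: (cvgc_conj (dot_cvg x y)).
congr cvgc; apply/funext => n; rewrite rmorph_sum; apply: eq_bigr => k _.
by rewrite [LHS]conjcM conjcK mulrC.
Qed.

Lemma dotDr x y z : ell2_dot x (y + z) = ell2_dot x y + ell2_dot x z.
Proof. by rewrite dotC dotDl conjcD -!dotC. Qed.

Lemma dotZr c x y : ell2_dot x (c *: y) = conjc c * ell2_dot x y.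
Proof. by rewrite dotC dotZl conjcM -dotC. Qed.

Lemma dotNl x y : ell2_dot (- x) y = - ell2_dot x y.
Proof. by rewrite -scaleN1r dotZl mulN1r. Qed.

Lemma dotNr x y : ell2_dot x (- y) = - ell2_dot x y.
Proof. by rewrite dotC dotNl conjcN -dotC. Qed.

Lemma dotBl x y z : ell2_dot (x - y) z = ell2_dot x z - ell2_dot y z.
Proof. by rewrite dotDl dotNl. Qed.

Lemma dotBr x y z : ell2_dot x (y - z) = ell2_dot x y - ell2_dot x z.
Proof. by rewrite dotDr dotNr. Qed.

Lemma dot0l x : ell2_dot 0 x = 0.
Proof. by rewrite -(scale0r x) dotZl mul0r. Qed.

Lemma dot_suml (I : Type) (s : seq I) (P : pred I) (F : I -> H) y :
  ell2_dot (\sum_(i <- s | P i) F i) y = \sum_(i <- s | P i) ell2_dot (F i) y.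
Proof.
elim/big_rec2: _ => [|i u v _ <-]; first exact: dot0l.
exact: dotDl.
Qed.

Lemma dot_norm x : ell2_dot x x = ('N x ^+ 2)%:C.
Proof.
apply: cvgc_uniq (dot_cvg _ _) _.
have -> : (fun n => \sum_(0 <= k < n) x k * conjc (x k)) = (fun n => (sqsum x n)%:C).
  by apply/funext => n; rewrite rmorph_sum; apply: eq_bigr => k _; rewrite mulc_conj.
split=> /=; first by rewrite sqr_ell2_norm; exact: cvg_sqsum.
exact: cvg_cst.
Qed.

Lemma cauchy_schwarz x y : normc (ell2_dot x y) <= 'N x * 'N y.
Proof.
have [/ell2_norm0_eq0 ->|y0] := eqVneq ('N y) 0.
  by rewrite dotC dot0l rmorph0 Normc.normc0 norm0 mulr0.
have y_gt0 : 0 < 'N y by rewrite lt0r y0 ell2_norm_ge0.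
set w := ell2_dot x y.
(* [t *: y] is the orthogonal projection of [x] onto the line of [y]; the inequality says that the
   squared norm of the remainder is nonnegative. *)
pose t := w * (('N y ^+ 2)^-1)%:C.
have : ell2_dot (x - t *: y) (x - t *: y) =
    ('N x ^+ 2 - normc w ^+ 2 * ('N y ^+ 2)^-1)%:C.
  rewrite dotBl !dotBr !dotZl !dotZr !dot_norm (dotC x y) -/w.
  rewrite /t conjcM conjc_real.
  have wc := mulc_conj w.
  have yy : (('N y ^+ 2)^-1)%:C * ('N y ^+ 2)%:C = 1 :> R[i].
    by rewrite -rmorphM/= mulVf// expf_neq0.
  have -> : ('N x ^+ 2 - normc w ^+ 2 * ('N y ^+ 2)^-1)%:C =
      ('N x ^+ 2)%:C - (normc w ^+ 2)%:C * (('N y ^+ 2)^-1)%:C.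
    by rewrite realcB (realcM (normc w ^+ 2)).
  rewrite -wc; move: yy; move: (_%:C) (_%:C) (('N x ^+ 2)%:C) => q Y X qY.
  ring: qY.
rewrite dot_norm => /complexI nE.
have : 0 <= 'N x ^+ 2 - normc w ^+ 2 * ('N y ^+ 2)^-1 by rewrite -nE sqr_ge0.
rewrite subr_ge0 ler_pdivrMr ?exprn_gt0// -exprMn.
by rewrite ler_pXn2r ?nnegrE ?mulr_ge0 ?ell2_norm_ge0 ?normc_ge0.
Qed.

Lemma dot_single x y n : (forall k, k != n -> x k * conjc (y k) = 0) ->
  ell2_dot x y = x n * conjc (y n).
Proof.
move=> xy0; apply: cvgc_uniq (dot_cvg _ _) _; apply: (@cvgc_near_cst _ _ _ n.+1) => m nm.
rewrite big_mkord (bigD1 (Ordinal nm))//= big1 ?addr0// => i ine.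
exact: xy0.
Qed.

Definition delta (n : nat) : nat -> R[i] := fun k => (k == n)%:R.

Lemma delta_summable n : delta n \in @square_summable R.
Proof.
apply: (@square_summable_bound _ 1) => m.
have [nm|mn] := ltnP n m.
  rewrite /sqsum /series/= big_mkord (bigD1 (Ordinal nm))//= big1 => [|i ine].
    by rewrite /delta eqxx Normc.normc1 expr1n addr0.
  by rewrite /delta (negbTE (_ : i != n :> nat))// Normc.normc0 expr0n.
rewrite /sqsum /series/= big1_seq// => i; rewrite mem_index_iota/= => im.
rewrite /delta (_ : i == n = false) ?Normc.normc0 ?expr0n//.
by apply/negbTE; rewrite neq_ltn (leq_trans im).
Qed.

Definition unitv n : H := Ell2 (delta_summable n).

Lemma unitvE n k : unitv n k = (k == n)%:R. Proof. by []. Qed.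

Lemma dot_unitvr x n : ell2_dot x (unitv n) = x n.
Proof.
rewrite (@dot_single _ _ n) => [|k kn]; last by rewrite unitvE (negbTE kn) rmorph0 mulr0.
by rewrite unitvE eqxx rmorph1 mulr1.
Qed.

Lemma dot_unitvl x n : ell2_dot (unitv n) x = conjc (x n).
Proof. by rewrite dotC dot_unitvr. Qed.

Lemma dot_ext x y : (forall z, ell2_dot z x = ell2_dot z y) -> x = y.
Proof.
by move=> xy; apply: ell2P => n; apply: (can_inj (@conjcK R)); rewrite -!dot_unitvl.
Qed.

Definition comb n (c : nat -> R[i]) : H := \sum_(0 <= k < n) c k *: unitv k.

Lemma combE n (c : nat -> R[i]) k : comb n c k = if (k < n)%N then c k else 0.
Proof.
rewrite /comb ell2_sumE; case: ltnP => [kn|nk].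
  rewrite big_mkord (bigD1 (Ordinal kn))//= ell2ZE unitvE eqxx mulr1 big1 ?addr0// => i ik.
  by rewrite ell2ZE unitvE eq_sym (negbTE (_ : i != k :> nat)) ?mulr0.
rewrite big1_seq// => i; rewrite mem_index_iota/= => im.
by rewrite ell2ZE unitvE (gtn_eqF (leq_trans im nk)) mulr0.
Qed.

Lemma sqr_norm_comb n (c : nat -> R[i]) : 'N (comb n c) ^+ 2 = \sum_(0 <= k < n) normc (c k) ^+ 2.
Proof.
apply: complexI; rewrite -dot_norm {1}/comb dot_suml rmorph_sum big_nat [RHS]big_nat.
apply: eq_bigr => k /= kn.
by rewrite dotZl dot_unitvl combE kn mulc_conj.
Qed.

Definition tail n x : H := x - comb n x.

Lemma tailE n x k : tail n x k = if (k < n)%N then 0 else x k.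
Proof. by rewrite /tail ell2BE combE; case: ifP; rewrite ?subrr ?subr0. Qed.

Lemma tailD n x y : tail n (x + y) = tail n x + tail n y.
Proof.
by apply: ell2P => k; rewrite !(tailE, ell2DE); case: ifP; rewrite ?addr0.
Qed.

Lemma tailN n x : tail n (- x) = - tail n x.
Proof.
by apply: ell2P => k; rewrite !(tailE, ell2NE); case: ifP; rewrite ?oppr0.
Qed.

Lemma tailB n x y : tail n (x - y) = tail n x - tail n y.
Proof. by rewrite tailD tailN. Qed.

Lemma tailZ n c x : tail n (c *: x) = c *: tail n x.
Proof.
by apply: ell2P => k; rewrite !(tailE, ell2ZE); case: ifP; rewrite ?mulr0.
Qed.

Lemma norm_tail_mono m n x : (m <= n)%N -> 'N (tail n x) <= 'N (tail m x).
Proof.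
move=> mn; apply: norm_le_coord => k; rewrite !tailE.
case: ifP => kn; case: ifP => km //; rewrite ?Normc.normc0 ?normc_ge0//.
by rewrite (leq_trans km mn) in kn.
Qed.

Lemma norm_tail_le n x : 'N (tail n x) <= 'N x.
Proof.
by apply: norm_le_coord => k; rewrite tailE; case: ifP; rewrite ?Normc.normc0 ?normc_ge0.
Qed.

Lemma tail_small x e : 0 < e -> exists n, forall m, (n <= m)%N -> 'N (tail m x) <= e.
Proof.
move=> e0; have := @cvg_sqsum R x; move=> /cvgrPdist_le/(_ (e ^+ 2)).
rewrite exprn_gt0// => /(_ isT)[n _ nP]; exists n => m nm.
apply: le_trans (norm_tail_mono _ nm) _.
apply: norm_sqsum_le (ltW e0) => k.
have := nP n (leqnn n) => /=; rewrite ger0_norm ?subr_ge0 ?sqsum_le// => {nP} nP.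
apply: le_trans nP; rewrite lerBrDr; apply: le_trans (sqsum_le x (maxn k n)).
rewrite /sqsum /series/= (big_cat_nat (n := n) _ (leq_maxr k n))//= [leRHS]addrC lerD2r.
have [kn|nk] := leqP k n.
  rewrite big1_seq ?sumr_ge0// => [i _|i]; first exact: sqr_ge0.
  rewrite mem_index_iota/= => ik.
  by rewrite tailE (leq_trans ik kn) Normc.normc0 expr0n.
rewrite (big_cat_nat (n := n) _ (ltnW nk))//= big1_seq ?add0r => [|i]; last first.
  by rewrite mem_index_iota/= => ik; rewrite tailE ik Normc.normc0 expr0n.
apply: ler_sum_nat => i /andP[ni _].
by rewrite tailE ltnNge ni.
Qed.

End Ell2Theory.

Local Opaque to_ell2.

(** * Bounded and compact operators *)

Section Operators.
Variable R : realType.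
Local Notation H := (ell2 R).
Local Notation "''N' x" := (ell2_norm x) (at level 10).
Local Notation e_ := (@unitv R).
Implicit Types (x y z : H) (c : R[i]) (A B S T : H -> H).

Lemma cvgc_normc (u : nat -> R[i]) l :
  (forall e, 0 < e -> exists N, forall n, (N <= n)%N -> normc (u n - l) <= e) -> cvgc u l.
Proof.
move=> ul; split; apply/cvgrPdist_le => e e0; have [N NP] := ul e e0; exists N => // n /NP;
  apply: le_trans; rewrite distrC -raddfB/=; [exact: normc_Re|exact: normc_Im].
Qed.

Section Linear.
Variable T : H -> H.
Hypothesis Tlin : linear T.

Lemma linD x y : T (x + y) = T x + T y.
Proof. by have := Tlin 1 x y; rewrite !scale1r. Qed.

Lemma lin0 : T 0 = 0.
Proof. by apply: (addIr (T 0)); rewrite -linD !add0r. Qed.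

Lemma linZ c x : T (c *: x) = c *: T x.
Proof. by have := Tlin c x 0; rewrite lin0 !addr0. Qed.

Lemma linN x : T (- x) = - T x.
Proof. by rewrite -scaleN1r linZ scaleN1r. Qed.

Lemma linB x y : T (x - y) = T x - T y.
Proof. by rewrite linD linN. Qed.

Lemma lin_sum (I : Type) (s : seq I) (P : pred I) (F : I -> H) :
  T (\sum_(i <- s | P i) F i) = \sum_(i <- s | P i) T (F i).
Proof. by elim/big_rec2: _ => [|i u v _ <-]; rewrite ?lin0 ?linD. Qed.

End Linear.

Lemma bounded_operatorP T : bounded_operator T <->
  linear T /\ exists2 M, 0 <= M & forall x, 'N (T x) <= M * 'N x.
Proof.
split=> [[Tlin [M MP]]|[Tlin [M M0 MP]]]; split=> //; last first.
  by exists M%:C => x; rewrite !ell2_normE -rmorphM/= lecR.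
(* The order on [R[i]] forces equal imaginary parts and compares real parts, so the real part of [M]
   already gives the bound. *)
exists `|complex.Re M| => // x; have := MP x.
rewrite !ell2_normE lecE => /andP[_]; case: M {MP} => a b /=; rewrite mulr0 subr0.
by move=> /le_trans; apply; rewrite ler_wpM2r ?ell2_norm_ge0// ler_norm.
Qed.

Lemma bounded_operator_linear T : bounded_operator T -> linear T.
Proof. by case. Qed.

Lemma bounded_operator_norm T : bounded_operator T ->
  exists2 M, 0 < M & forall x, 'N (T x) <= M * 'N x.
Proof.
move=> /bounded_operatorP[_ [M M0 MP]]; exists (M + 1); first by rewrite ltr_wpDl.
by move=> x; apply: le_trans (MP x) _; rewrite ler_wpM2r ?ell2_norm_ge0 ?lerDl.
Qed.

Lemma bounded_operator_lin c A B : bounded_operator A -> bounded_operator B ->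
  bounded_operator (c *: A + B).
Proof.
move=> /bounded_operatorP[lA [M M0 MP]] /bounded_operatorP[lB [M' M'0 M'P]].
apply/bounded_operatorP; split=> [a x y|].
  rewrite -![(c *: A + B) _]/(c *: A _ + B _) lA lB scalerDr scalerDr !scalerA (mulrC c).
  by rewrite addrACA.
exists (normc c * M + M') => [|x]; first by rewrite addr_ge0// mulr_ge0 ?normc_ge0.
rewrite -[(c *: A + B) x]/(c *: A x + B x).
apply: le_trans (ell2_normD _ _) _; rewrite ell2_normZ mulrDl lerD//.
by rewrite -mulrA ler_wpM2l ?normc_ge0.
Qed.

Lemma bounded_operator_comp A B : bounded_operator A -> bounded_operator B ->
  bounded_operator (A \o B).
Proof.
move=> /bounded_operatorP[lA [M M0 MP]] /bounded_operatorP[lB [M' M'0 M'P]].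
apply/bounded_operatorP; split=> [a x y|]; first by rewrite /= lB lA.
exists (M * M') => [|x]; first by rewrite mulr_ge0.
by rewrite /= (le_trans (MP _))// -mulrA ler_wpM2l.
Qed.

Lemma bounded_operator_sub A B : bounded_operator A -> bounded_operator B ->
  bounded_operator (A - B).
Proof.
by move=> bA bB; have := bounded_operator_lin (-1) bB bA; rewrite scaleN1r addrC.
Qed.

Lemma bounded_operator0 : bounded_operator (0 : H -> H).
Proof.
apply/bounded_operatorP; split=> [a x y|].
  by rewrite -![(0 : H -> H) _]/(0 : H) scaler0 addr0.
by exists 0 => // x; rewrite -[X in 'N X]/(0 : H) norm0 mul0r.
Qed.

Lemma norm_le_eps x (M : R) : (forall e, 0 < e -> 'N x <= e * M) -> x = 0.
Proof.
move=> xM; apply: ell2_norm0_eq0; apply/le_anti; rewrite ell2_norm_ge0 andbT.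
apply/ler_addgt0Pl => e e0; rewrite addr0.
have M0 : 0 < `|M| + 1 by rewrite ltr_wpDl.
apply: (le_trans (xM (e / (`|M| + 1)) _)); first by rewrite divr_gt0.
rewrite -mulrA ler_piMr ?(ltW e0)// [leLHS]mulrC ler_pdivrMr// mul1r.
by rewrite (le_trans (ler_norm _))// lerDl.
Qed.

(** The difference kills all finite combinations of basis vectors, so its value at [x] is its value
    at each tail of [x], and tails tend to 0. *)
Lemma bounded_operator_ext S T : bounded_operator S -> bounded_operator T ->
  (forall n, S (e_ n) = T (e_ n)) -> S = T.
Proof.
move=> bS bT ST; have := bounded_operator_sub bS bT; set D := S - T => bD.
have De n : D (e_ n) = 0 by rewrite -[LHS]/(S (e_ n) - T (e_ n)) ST subrr.
suff D0 x : D x = 0 by apply/funext => x; apply/eqP; rewrite -subr_eq0; apply/eqP/D0.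
have [M M0 MP] := bounded_operator_norm bD.
apply: (@norm_le_eps _ M) => e e0; have [n nP] := tail_small x e0.
have -> : D x = D (tail n x).
  rewrite -[x in LHS](subrK (comb n x)) (linD (bounded_operator_linear bD)) -/(tail n x).
  rewrite /comb (lin_sum (bounded_operator_linear bD)) big1 ?addr0// => i _.
  by rewrite (linZ (bounded_operator_linear bD)) De scaler0.
by rewrite (le_trans (MP _))// mulrC ler_wpM2r ?(ltW M0)// nP.
Qed.

Fact adj_key : unit. Proof. exact: tt. Qed.
(** Adjointness forces the coordinate [n] to be [ell2_dot y (T (e_ n))]. *)
Definition adj : (H -> H) -> H -> H := locked_with adj_key
  (fun T y => to_ell2 (fun n => conjc (ell2_dot (T (e_ n)) y))).

Section Adjoint.
Variables (T : H -> H) (M : R).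
Hypotheses (Tlin : linear T) (M0 : 0 <= M) (TM : forall x, 'N (T x) <= M * 'N x).

Lemma adj_coord_bound y n :
  sqsum (fun n => conjc (ell2_dot (T (e_ n)) y)) n <= (M * 'N y) ^+ 2.
Proof.
(* Testing on [u] works because [ell2_dot (T u) y] equals the squared norm of [u]; Cauchy-Schwarz
   then allows one factor ['N u] to be cancelled. *)
set s := fun n => _; pose u := comb n s.
have uE : 'N u ^+ 2 = sqsum s n by exact: sqr_norm_comb.
have dE : ell2_dot (T u) y = (sqsum s n)%:C.
  rewrite /u /comb (lin_sum Tlin) dot_suml rmorph_sum; apply: eq_bigr => k _.
  rewrite (linZ Tlin) dotZl -[X in _ * X]conjcK; exact: mulc_conj.
have : 'N u ^+ 2 <= 'N u * (M * 'N y).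
  have := cauchy_schwarz (T u) y; rewrite dE -uE normcC ger0_norm ?sqr_ge0// => /le_trans.
  by apply; rewrite mulrA [_ * M]mulrC ler_wpM2r ?ell2_norm_ge0.
rewrite -uE; have := ell2_norm_ge0 u; rewrite le_eqVlt => /orP[/eqP <- _|u0].
  by rewrite expr0n/= sqr_ge0.
rewrite expr2 ler_pM2l// => h; rewrite -expr2 ler_pXn2r ?nnegrE ?mulr_ge0 ?ell2_norm_ge0//.
Qed.

Lemma adjE y n : adj T y n = conjc (ell2_dot (T (e_ n)) y).
Proof.
rewrite /adj unlock; exact/to_ell2E/square_summable_bound/adj_coord_bound.
Qed.

Lemma adj_norm y : 'N (adj T y) <= M * 'N y.
Proof.
apply: norm_sqsum_le => [n|]; last by rewrite mulr_ge0 ?ell2_norm_ge0.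
rewrite (_ : ell2_val _ = fun n => conjc (ell2_dot (T (e_ n)) y)).
  exact: adj_coord_bound.
by apply/funext => k; exact: adjE.
Qed.

Lemma adj_linear : linear (adj T).
Proof.
move=> c x y; apply: ell2P => n; rewrite [RHS]ell2DE [X in _ = X + _]ell2ZE !adjE.
by rewrite dotDr dotZr conjcD conjcM conjcK.
Qed.

Lemma adj_is_adjoint : is_adjoint T (adj T).
Proof.
(* These numbers tend to the left side by boundedness of [T], and they are the partial sums of the
   right side. *)
move=> x y; apply: (@cvgc_uniq _ (fun n => ell2_dot (T (comb n x)) y)).
  apply: cvgc_normc => e e0.
  have d0 : 0 < M * 'N y + 1 by rewrite ltr_wpDl ?mulr_ge0 ?ell2_norm_ge0.
  have [n nP] := @tail_small R x (e / (M * 'N y + 1)) (divr_gt0 e0 d0).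
  exists n => m /nP; rewrite ler_pdivlMr// => h.
  rewrite -normcN opprB -dotBl -(linB Tlin) -/(tail m x).
  apply: le_trans (cauchy_schwarz _ _) _; apply: le_trans h.
  apply: (@le_trans _ _ (M * 'N (tail m x) * 'N y)).
    by rewrite ler_wpM2r ?ell2_norm_ge0.
  by have := ell2_norm_ge0 (tail m x); nra.
move: (dot_cvg x (adj T y)); congr cvgc; apply/funext => n.
rewrite /comb (lin_sum Tlin) dot_suml; apply: eq_bigr => k _.
by rewrite (linZ Tlin) dotZl adjE conjcK.
Qed.

End Adjoint.

Lemma adjP T : bounded_operator T -> is_adjoint T (adj T).
Proof. by move=> /bounded_operatorP[lT [M M0 MP]]; exact: (adj_is_adjoint lT M0). Qed.

Lemma adj_bounded T : bounded_operator T -> bounded_operator (adj T).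
Proof.
move=> /bounded_operatorP[lT [M M0 MP]]; apply/bounded_operatorP; split.
  exact: (adj_linear lT M0).
by exists M => //; exact: adj_norm.
Qed.

Lemma is_adjoint_sym A B : is_adjoint A B -> is_adjoint B A.
Proof. by move=> AB x y; rewrite dotC -AB -dotC. Qed.

Lemma is_adjoint_uniq T A B : is_adjoint T A -> is_adjoint T B -> A = B.
Proof. by move=> TA TB; apply/funext => y; apply: dot_ext => x; rewrite -TA TB. Qed.

Lemma is_adjoint_comp A A' B B' : is_adjoint A A' -> is_adjoint B B' ->
  is_adjoint (A \o B) (B' \o A').
Proof. by move=> AA' BB' x y /=; rewrite AA' BB'. Qed.

Lemma is_adjoint_basis A B : bounded_operator A -> bounded_operator B ->
  (forall a b, A (e_ a) b = conjc (B (e_ b) a)) -> is_adjoint A B.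
Proof.
move=> bA bB AB; suff -> : B = adj A by exact: adjP.
apply: bounded_operator_ext => // [|b]; first exact: adj_bounded.
apply: ell2P => a; have /is_adjoint_sym AA := adjP bA.
by rewrite -[RHS]dot_unitvr AA dot_unitvl AB conjcK.
Qed.

End Operators.

(** * Compact operators and uniformly small tails *)

Section Compact.
Variable R : realType.
Local Notation H := (ell2 R).
Local Notation "''N' x" := (ell2_norm x) (at level 10).
Local Notation e_ := (@unitv R).
Implicit Types (x y z : H) (c : R[i]) (A B S T : H -> H).

Lemma norm_comb_sum n (c : nat -> R[i]) :
  'N (comb n c) <= \sum_(0 <= k < n) normc (c k).
Proof.
rewrite /comb; elim/big_ind2: _ => [|a u b v au bv|k _]; first by rewrite norm0.
  exact: le_trans (ell2_normD _ _) (lerD au bv).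
rewrite ell2_normZ ler_piMr ?normc_ge0//.
rewrite -(@ler_pXn2r _ 2) ?nnegrE ?ell2_norm_ge0// expr1n.
have /eqP := dot_norm (e_ k); rewrite dot_unitvr unitvE eqxx eq_complex /= => /andP[/eqP <- _].
by [].
Qed.

(** The model compact sets of ell2: with [nu 0 = 0] the value [b 0] bounds the norm, and small
    values [b k] make the tails uniformly small. *)
Definition tailbox (nu : nat -> nat) (b : nat -> R) : set H :=
  [set y | forall k, 'N (tail (nu k) y) <= b k].

Section Tailbox.
Variables (nu : nat -> nat) (b : nat -> R).
Hypotheses (nu0 : nu 0%N = 0%N) (b_small : forall e, 0 < e -> exists k, b k <= e).

Lemma tail0 x : tail 0 x = x.
Proof. by apply: ell2P => k; rewrite tailE ltn0. Qed.

Lemma tailbox_coord_cvg (F : set_system H) (g : R[i] -> R) n :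
  (forall w : R[i], `|g w| <= normc w) ->
  UltraFilter F -> F (tailbox nu b) ->
  exists r : R, (fun y : H => g (y n)) @ F --> r.
Proof.
move=> gle FU FK; have FP : ProperFilter F by exact: ultra_proper.
have [|r [_ rF]] := @segment_compact R (- b 0%N) (b 0%N) ((fun y : H => g (y n)) @ F) _.
  change (F ((fun y : H => g (y n)) @^-1` `[- b 0%N, b 0%N])).
  apply: filterS FK => y /(_ 0%N); rewrite nu0 tail0 => yb /=.
  rewrite in_itv/= -ler_norml; apply: le_trans (gle _) _.
  exact: le_trans (coord_le_norm y n) yb.
exists r => B rB; have [//|FB] := in_ultra_setVsetC ((fun y : H => g (y n)) @^-1` B) FU.
by have [t [nBt /nBt]] := rF (~` B) B FB rB.
Qed.

(** Along an ultrafilter on the box all coordinates converge. The coordinatewise limit satisfies the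
    same tail bounds, and small tails turn coordinatewise convergence into norm convergence: a
    finite head and two tails contribute [e / 3] each. *)
Lemma tailbox_compact : compact (tailbox nu b).
Proof.
rewrite compact_ultra => F FU FK.
have FP : ProperFilter F by exact: ultra_proper.
have [re reF] := choice (fun n => tailbox_coord_cvg n
  (@normc_Re R) FU FK).
have [im imF] := choice (fun n => tailbox_coord_cvg n
  (@normc_Im R) FU FK).
pose z n := re n +i* im n.
have zF n d : 0 < d -> \forall y \near F, forall k, (k < n)%N -> normc ((y : H) k - z k) <= d.
  move=> d0; elim: n => [|n IH]; first by apply: nearW.
  have d2 : 0 < d / 2 by rewrite divr_gt0.
  have := reF n => /cvgrPdist_le/(_ _ d2) h1; have := imF n => /cvgrPdist_le/(_ _ d2) h2.
  near=> y => k; rewrite ltnS leq_eqVlt => /orP[/eqP ->|kn]; last first.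
    by move: k kn; near: y.
  apply: le_trans (normc_le_ReIm _) _; rewrite (splitr d) lerD//.
    by rewrite raddfB/= distrC; near: y.
  by rewrite raddfB/= distrC; near: y.
(* The bound is shown for finite sections first, because [z] is not yet known to be square summable;
   that follows from the case [k = 0]. *)
have zb k m : 'N (tail (nu k) (comb m z)) <= b k.
  apply/ler_addgt0Pl => e e0.
  have d0 : 0 < e / m.+1%:R by rewrite divr_gt0.
  have FKz : F (tailbox nu b `&` [set y : H | forall k, (k < m)%N ->
    normc (y k - z k) <= e / m.+1%:R]) by apply: filterI FK _; exact: zF.
  have [y [yK yz]] := filter_ex FKz.
  pose w n := z n - y n.
  have -> : tail (nu k) (comb m z) = tail (nu k) (comb m w) + tail (nu k) (comb m y).
    rewrite -tailD; congr tail; apply: ell2P => n; rewrite [RHS]ell2DE !combE /w.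
    by case: ifP; rewrite ?subrK ?addr0.
  apply: le_trans (ell2_normD _ _) (lerD _ _).
    apply: le_trans (norm_tail_le _ _) _; apply: le_trans (norm_comb_sum _ _) _.
    rewrite big_mkord; apply: (@le_trans _ _ (\sum_(i < m) (e / m.+1%:R))).
      by apply: ler_sum => i _; rewrite /w -normcN opprB; exact: yz.
    rewrite sumr_const card_ord -[leLHS]mulr_natr -[leLHS]mulrA ler_piMr ?(ltW e0)//.
    by rewrite ler_pdivrMl// mulr1 ler_nat.
  apply: le_trans (yK k); apply: norm_le_coord => n; rewrite !tailE !combE.
  by case: ifP => // _; case: ifP; rewrite // Normc.normc0 normc_ge0.
have zs : z \in @square_summable R.
  apply: (@square_summable_bound _ _ (b 0%N ^+ 2)) => n.
  have := zb 0%N n; rewrite nu0 tail0 => h; rewrite -[sqsum z n]sqr_norm_comb.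
  by rewrite ler_pXn2r ?nnegrE ?ell2_norm_ge0// (le_trans (ell2_norm_ge0 _) h).
pose zz := to_ell2 z.
have zzE n : zz n = z n by exact: to_ell2E.
have zzK : tailbox nu b zz.
  move=> k; have bk := zb k 0%N; apply: norm_sqsum_le (le_trans (ell2_norm_ge0 _) bk) => n.
  rewrite -[sqsum _ n]sqr_norm_comb.
  have -> : comb n (tail (nu k) zz) = tail (nu k) (comb n z).
    by apply: ell2P => j; rewrite tailE !combE tailE zzE; case: ifP; case: ifP.
  by rewrite ler_pXn2r ?nnegrE ?ell2_norm_ge0// (le_trans (ell2_norm_ge0 _) bk).
exists zz; split=> //; apply/cvgrPdist_le => e.
(* The radius is an element of [R[i]]; being positive, it is real. *)
case: e => e e'; rewrite ltcE/= => /andP[/eqP -> e0].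
have e30 : 0 < e / 3 by rewrite divr_gt0.
have [k bk] := b_small e30.
have d0 : 0 < e / 3 / (nu k).+1%:R by rewrite divr_gt0.
apply: filterS2 FK (zF (nu k) _ d0) => y yK yz.
rewrite ell2_normE -[_ +i* _]/(e%:C) lecR.
pose w n := z n - y n.
have -> : zz - y = comb (nu k) w + (tail (nu k) zz - tail (nu k) y).
  apply: ell2P => j; rewrite [LHS]ell2BE [RHS]ell2DE combE ell2BE !tailE zzE /w.
  by case: ifP; rewrite ?subrr ?addr0 ?add0r.
apply: le_trans (ell2_normD _ _) _.
have -> : e = e / 3 + (e / 3 + e / 3) by field.
apply: lerD; last first.
  apply: le_trans (ell2_normB _ _) (lerD _ _); first exact: le_trans (zzK k) bk.
  exact: le_trans (yK k) bk.
apply: le_trans (norm_comb_sum _ _) _.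
rewrite big_mkord; apply: (@le_trans _ _ (\sum_(i < nu k) (e / 3 / (nu k).+1%:R))).
  by apply: ler_sum => i _; rewrite /w -normcN opprB; exact: yz.
rewrite sumr_const card_ord -[leLHS]mulr_natr -[leLHS]mulrA ler_piMr ?(ltW e30)//.
by rewrite ler_pdivrMl// mulr1 ler_nat.
Unshelve. all: by end_near. Qed.

End Tailbox.

(** The norm of [T] followed by [tail n] tends to 0. By [compact_operatorP] this characterises
    compactness of bounded operators, and the closure properties below are proved through it. *)
Definition uniform_tails T : Prop :=
  forall e, 0 < e -> exists n, forall x, 'N (tail n (T x)) <= e * 'N x.

Lemma norm_le1 x : (`|x| <= 1) = ('N x <= 1).
Proof. by rewrite ell2_normE -lecR. Qed.

Lemma uniform_tails_precompact T : bounded_operator T -> uniform_tails T ->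
  precompact (T @` [set x | `|x| <= 1]).
Proof.
move=> /bounded_operatorP[_ [M M0 MP]] tT.
have [nu nuP] := choice (fun k : nat => tT k.+1%:R^-1 (ltac:(by rewrite invr_gt0))).
(* The index 0 is reserved for the norm bound [M]; the tail bounds are shifted by one. *)
pose nu' k := if k is k'.+1 then nu k' else 0%N.
pose b k : R := if k is k'.+1 then k'.+1%:R^-1 else M.
apply: (@precompact_subset _ _ (tailbox nu' b)).
  move=> _ [x /= + <-] k; rewrite norm_le1 => x1; case: k => [|k] /=.
    by rewrite tail0 (le_trans (MP x))// ler_piMr.
  by rewrite (le_trans (nuP k x))// ler_piMr// invr_ge0.
apply: compact_precompact; first exact: norm_hausdorff.
apply: tailbox_compact => // e e0.
have [n nP] := @ltr_add_invr R 0 e e0.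
by exists n.+1 => /=; rewrite add0r in nP; exact: ltW.
Qed.

(** Otherwise there are points [f n] of the image of the unit ball whose tails from [n] on exceed
    [e]. They have a cluster point [p], whose tails become small, and so do those of any [f n] close
    to [p]. *)
Lemma precompact_uniform_tails T : bounded_operator T ->
  precompact (T @` [set x | `|x| <= 1]) -> uniform_tails T.
Proof.
move=> bT; have lT := bounded_operator_linear bT; rewrite precompactE => cT e e0.
apply: contrapT => nex.
have {nex} nex n : exists y, (T @` [set x | `|x| <= 1]) y /\ e < 'N (tail n y).
  apply: contrapT => ny; apply: nex; exists n => x.
  have [/ell2_norm0_eq0 ->|x0] := eqVneq ('N x) 0.
    by rewrite (lin0 lT) norm0 mulr0 (le_trans (norm_tail_le _ _))// norm0.
  have x_gt0 : 0 < 'N x by rewrite lt0r x0 ell2_norm_ge0.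
  rewrite leNgt; apply/negP => h; apply: ny; exists (T (('N x)^-1%:C *: x)); split.
    exists (('N x)^-1%:C *: x) => //=.
    by rewrite norm_le1 ell2_normZ normcC ger0_norm ?invr_ge0 ?ell2_norm_ge0// mulVf.
  rewrite (linZ lT) tailZ ell2_normZ normcC ger0_norm ?invr_ge0 ?ell2_norm_ge0//.
  by rewrite ltr_pdivlMl// mulrC.
have [f fP] := choice nex.
have [|p [_ pF]] := cT (f @ \oo) _.
  by exists 0%N => // n _ /=; apply: subset_closure; case: (fP n).
have e20 : 0 < e / 2 by rewrite divr_gt0.
have [k kP] := tail_small p e20.
have e2C : 0 < (e / 2)%:C :> R[i] by rewrite ltcR.
have [|_ [[n /= kn <-] pfn]] := pF [set f n | n in [set n | (k <= n)%N]]
  (ball p (e / 2)%:C) _ (nbhsx_ballx _ _ e2C).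
  by exists k => // n /= kn; exists n.
have [_] := fP n; apply/negP; rewrite -leNgt.
have -> : tail n (f n) = tail n p - tail n (p - f n) by rewrite tailB opprB addrC subrK.
apply: le_trans (ell2_normB _ _) _; rewrite (splitr e).
apply: lerD; first exact: kP.
apply: le_trans (norm_tail_le _ _) _.
by move: pfn; rewrite -ball_normE /ball_/= ell2_normE ltcR => /ltW.
Qed.

Lemma compact_operatorP T :
  compact_operator T <-> bounded_operator T /\ uniform_tails T.
Proof.
split=> -[bT cT]; split=> //; first exact: precompact_uniform_tails.
exact: uniform_tails_precompact.
Qed.

Lemma compact_operator_bounded T : compact_operator T -> bounded_operator T.
Proof. by case. Qed.

Lemma compact_operator0 : compact_operator (0 : H -> H).
Proof.
apply/compact_operatorP; split=> [|e e0]; first exact: bounded_operator0.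
exists 0%N => x; rewrite tail0 -[X in 'N X]/(0 : H) norm0.
by rewrite mulr_ge0 ?ell2_norm_ge0 ?ltW.
Qed.

Lemma uniform_tails_max A B e : uniform_tails A -> uniform_tails B -> 0 < e ->
  exists n, forall x, 'N (tail n (A x)) <= e * 'N x /\ 'N (tail n (B x)) <= e * 'N x.
Proof.
move=> tA tB e0; have [n nP] := tA e e0; have [m mP] := tB e e0.
exists (maxn n m) => x; split.
  exact: le_trans (norm_tail_mono _ (leq_maxl _ _)) (nP x).
exact: le_trans (norm_tail_mono _ (leq_maxr _ _)) (mP x).
Qed.

Lemma compact_lin c A B : compact_operator A -> compact_operator B ->
  compact_operator (c *: A + B).
Proof.
move=> /compact_operatorP[bA tA] /compact_operatorP[bB tB].
apply/compact_operatorP; split=> [|e e0]; first exact: bounded_operator_lin.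
have d0 : 0 < normc c + 1 by rewrite ltr_wpDl// normc_ge0.
have [n nP] := uniform_tails_max tA tB (divr_gt0 e0 d0).
exists n => x; rewrite -[(c *: A + B) x]/(c *: A x + B x) tailD tailZ.
apply: le_trans (ell2_normD _ _) _; rewrite ell2_normZ; have [hA hB] := nP x.
have -> : e * 'N x = normc c * (e / (normc c + 1) * 'N x) + e / (normc c + 1) * 'N x.
  by field; rewrite gt_eqF.
by apply: lerD => //; rewrite ler_wpM2l ?normc_ge0.
Qed.

Lemma compact_compr A B : compact_operator A -> bounded_operator B ->
  compact_operator (A \o B).
Proof.
move=> /compact_operatorP[bA tA] bB; apply/compact_operatorP.
split=> [|e e0]; first exact: bounded_operator_comp.
have [M M0 MP] := bounded_operator_norm bB.
have [n nP] := tA _ (divr_gt0 e0 M0); exists n => x /=.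
apply: le_trans (nP _) _; rewrite -mulrA ler_wpM2l ?(ltW e0)//.
by rewrite ler_pdivrMl.
Qed.

Lemma compact_limit T : bounded_operator T ->
  (forall e, 0 < e -> exists2 A, compact_operator A & forall x, 'N (T x - A x) <= e * 'N x) ->
  compact_operator T.
Proof.
move=> bT TA; apply/compact_operatorP; split=> // e e0.
have e20 : 0 < e / 2 by rewrite divr_gt0.
have [A /compact_operatorP[_ tA] AP] := TA _ e20.
have [n nP] := tA _ e20; exists n => x.
rewrite -(subrK (A x) (T x)) tailD (le_trans (ell2_normD _ _))// (splitr e) mulrDl.
by rewrite lerD// (le_trans (norm_tail_le _ _)).
Qed.

Lemma compact_adj T : compact_operator T -> compact_operator (adj T).
Proof.
move=> /compact_operatorP[bT tT]; have bS := adj_bounded bT; set S := adj T in bS *.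
have lS := bounded_operator_linear bS; have aT : is_adjoint T S := adjP bT.
apply/compact_operatorP; split=> // e e0.
have e20 : 0 < e / 2 by rewrite divr_gt0.
have [k kP] := tT _ e20.
have [M M0 MP] := bounded_operator_norm bS.
(* The squared norm of [S (tail k y)] is the product of [tail k (T (S (tail k y)))] with [y], since
   [tail k] is self-adjoint; the tail bound for [T] applies. *)
have Stail y : 'N (S (tail k y)) <= e / 2 * 'N y.
  have := cauchy_schwarz (tail k (T (S (tail k y)))) y.
  have -> : ell2_dot (tail k (T (S (tail k y)))) y = ell2_dot (T (S (tail k y))) (tail k y).
    apply: cvgc_uniq (dot_cvg _ _) _; move: (dot_cvg (T (S (tail k y))) (tail k y)).
    congr cvgc; apply/funext => n; apply: eq_bigr => j _; rewrite !tailE.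
    by case: ifP; rewrite ?rmorph0 ?mul0r ?mulr0.
  rewrite aT dot_norm normcC ger0_norm ?sqr_ge0//.
  have := kP (S (tail k y)); set u := 'N (tail k _); set s := 'N (S _) => us h.
  have s0 : 0 <= s := ell2_norm_ge0 _; have := s0.
  rewrite le_eqVlt => /orP[/eqP <-|s_gt0]; first by rewrite mulr_ge0 ?ell2_norm_ge0 ?ltW.
  rewrite -(ler_pM2l s_gt0) -expr2; apply: le_trans h _.
  by rewrite mulrA [s * _]mulrC ler_wpM2r ?ell2_norm_ge0.
(* The remaining part [S (comb k y)] is a combination of [k] fixed vectors, whose tails are made
   small together; the division by [k.+1] pays for the sum. *)
have [n nP] : exists n, forall j, (j < k)%N -> 'N (tail n (S (e_ j))) <= e / 2 / k.+1%:R.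
  have d0 : 0 < e / 2 / k.+1%:R by rewrite divr_gt0.
  move: d0; set d := _ / _ => d0; elim: (k) => [|l [n nP]]; first by exists 0%N.
  have [m mP] := tail_small (S (e_ l)) d0.
  exists (maxn n m) => j; rewrite ltnS leq_eqVlt => /orP[/eqP ->|jl].
    by apply: mP; exact: leq_maxr.
  exact: le_trans (norm_tail_mono _ (leq_maxl _ _)) (nP j jl).
exists n => y.
have -> : S y = S (comb k y) + S (tail k y) by rewrite -(linD lS) /tail addrC subrK.
rewrite tailD; apply: le_trans (ell2_normD _ _) _.
rewrite [leRHS](_ : _ = e / 2 * 'N y + e / 2 * 'N y); last by field.
apply: lerD; last exact: le_trans (norm_tail_le _ _) (Stail y).
rewrite /comb (lin_sum lS).
have -> : tail n (\sum_(0 <= i < k) S (y i *: e_ i)) = \sum_(0 <= i < k) y i *: tail n (S (e_ i)).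
  elim/big_rec2: _ => [|i u v _ <-]; first by apply: ell2P => j; rewrite tailE if_same.
  by rewrite tailD (linZ lS) tailZ.
apply: (@le_trans _ _ (\sum_(0 <= i < k) 'N y * (e / 2 / k.+1%:R))).
  rewrite big_nat [leRHS]big_nat; elim/big_ind2: _ => [|a u b v au bv|i /andP[_ ik]].
  - by rewrite norm0.
  - exact: le_trans (ell2_normD _ _) (lerD au bv).
  by rewrite ell2_normZ ler_pM ?normc_ge0 ?ell2_norm_ge0 ?coord_le_norm ?nP.
rewrite big_mkord sumr_const card_ord -[leLHS]mulr_natr -[leLHS]mulrA [leRHS]mulrC.
rewrite ler_wpM2l ?ell2_norm_ge0// -[leLHS]mulrA ler_piMr ?(ltW e20)//.
by rewrite ler_pdivrMl// mulr1 ler_nat.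
Qed.

(** Adjoints turn composition on the left into composition on the right. *)
Lemma compact_compl A B : compact_operator A -> bounded_operator B ->
  compact_operator (B \o A).
Proof.
move=> cA bB; have bA := compact_operator_bounded cA.
have cAB := compact_adj (compact_compr (compact_adj cA) (adj_bounded bB)).
suff -> : B \o A = adj (adj A \o adj B) by [].
apply: (@is_adjoint_uniq _ (adj A \o adj B)).
  exact: is_adjoint_comp (is_adjoint_sym (adjP bA)) (is_adjoint_sym (adjP bB)).
by apply: adjP; apply: bounded_operator_comp; exact: adj_bounded.
Qed.

(** The squared norm of [T (e_ m)] is the coordinate [m] of [adj T (T (e_ m))], and the compact
    operator [adj T] has uniformly small tails. *)
Lemma compact_unitv T : compact_operator T ->
  forall e, 0 < e -> exists n, forall m, (n <= m)%N -> 'N (T (e_ m)) <= e.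
Proof.
move=> cT e e0; have aT := adjP (compact_operator_bounded cT).
have /compact_operatorP[_ tS] := compact_adj cT.
have [n nP] := tS e e0; exists n => m nm; set s := 'N _.
have : s ^+ 2 <= e * s.
  have -> : s ^+ 2 = normc (adj T (T (e_ m)) m).
    rewrite -normc_conj -dot_unitvl -aT dot_norm normcC ger0_norm ?sqr_ge0//.
  have <- : tail n (adj T (T (e_ m))) m = adj T (T (e_ m)) m by rewrite tailE ltnNge nm.
  exact: le_trans (coord_le_norm _ _) (nP _).
have := ell2_norm_ge0 (T (e_ m)); rewrite -/s le_eqVlt => /orP[/eqP <-|s0].
  by rewrite (ltW e0).
by rewrite expr2 ler_pM2r.
Qed.

End Compact.

(** * Amplification of the compact operators *)

Section SquareSums.
Variable R : realType.
Local Notation H := (ell2 R).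
Local Notation "''N' x" := (ell2_norm x) (at level 10).
Implicit Types (u : nat -> R[i]) (x : H).

(** Extended reals make nonnegative sums over any index type available and freely rearrangeable. *)
Definition esq u (n : nat) : \bar R := (normc (u n) ^+ 2)%:E.

Lemma esq_ge0 u n : (0 <= esq u n)%E.
Proof. by rewrite lee_fin sqr_ge0. Qed.

Lemma esum_sqsum u n : ((sqsum u n)%:E <= \esum_(k in [set: nat]) esq u k)%E.
Proof.
rewrite -nneseries_esumT; last by move=> k; exact: esq_ge0.
rewrite -sumEFin; apply: nneseries_lim_ge => k _ _; exact: esq_ge0.
Qed.

Lemma esum_ell2 x : (\esum_(k in [set: nat]) esq x k = ('N x ^+ 2)%:E)%E.
Proof.
rewrite -nneseries_esumT; last by move=> k; exact: esq_ge0.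
rewrite sqr_ell2_norm -EFin_lim; last exact: cvg_sqsum.
by congr (limn _); apply/funext => n; rewrite /= -sumEFin.
Qed.

Lemma esum_inj_le (I : choiceType) (f : I -> nat) u : injective f ->
  (\esum_(p in [set: I]) esq u (f p) <= \esum_(k in [set: nat]) esq u k)%E.
Proof.
move=> finj; rewrite -(@esum_image _ _ _ setT f (esq u)); last by move=> a b _ _ /finj.
rewrite esum_mkcond; apply: le_esum => k _; case: ifP => // _; exact: esq_ge0.
Qed.

Lemma esum_supp (I : choiceType) (f : I -> nat) u : injective f ->
  (forall n, (forall p, f p <> n) -> u n = 0) ->
  (\esum_(k in [set: nat]) esq u k = \esum_(p in [set: I]) esq u (f p))%E.
Proof.
move=> finj u0; rewrite -(@esum_image _ _ _ setT f (esq u)); last by move=> a b _ _ /finj.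
rewrite [RHS]esum_mkcond; apply: eq_esum => k _; case: ifPn => //; rewrite notin_setE => nk.
by rewrite /esq u0 ?Normc.normc0 ?expr0n// => p fp; apply: nk; exists p.
Qed.

End SquareSums.

(** * Reading coordinates along an injection *)

Section Restriction.
Variable R : realType.
Local Notation H := (ell2 R).
Local Notation "''N' x" := (ell2_norm x) (at level 10).
Local Notation e_ := (@unitv R).
Implicit Types (x y z : H) (c : R[i]).

Fact restr_key : unit. Proof. exact: tt. Qed.
(** For injective [f], the adjoint of [restr f] is the isometric embedding that takes [e_ n] to
    [e_ (f n)]; lemmas about it carry the prefix [ext]. *)
Definition restr : (nat -> nat) -> H -> H :=
  locked_with restr_key (fun f x => to_ell2 (fun n => x (f n))).

Section OneMap.
Variables (f : nat -> nat) (finj : injective f).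

Lemma restr_sqsum x n : sqsum (fun n => x (f n)) n <= 'N x ^+ 2.
Proof.
rewrite -lee_fin -esum_ell2; apply: le_trans (esum_sqsum _ _) _.
exact: (@esum_inj_le _ _ f x finj).
Qed.

Lemma restrE x n : restr f x n = x (f n).
Proof. by rewrite /restr unlock; apply/to_ell2E/square_summable_bound/restr_sqsum. Qed.

Lemma restr_norm x : 'N (restr f x) <= 'N x.
Proof.
apply: norm_sqsum_le (ell2_norm_ge0 x) => n.
rewrite (_ : ell2_val _ = fun n => x (f n)); first exact: restr_sqsum.
by apply/funext => k; exact: restrE.
Qed.

Lemma restr_linear : linear (restr f).
Proof.
move=> c x y; apply: ell2P => n.
by rewrite restrE [RHS]ell2DE [X in _ = X + _]ell2ZE !restrE.
Qed.

Lemma restr_bounded : bounded_operator (restr f).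
Proof.
apply/bounded_operatorP; split; first exact: restr_linear.
by exists 1 => // x; rewrite mul1r restr_norm.
Qed.

Lemma restr_unitv a : restr f (e_ (f a)) = e_ a.
Proof. by apply: ell2P => n; rewrite restrE !unitvE (inj_eq finj). Qed.

Lemma restr_unitv0 n : (forall a, f a <> n) -> restr f (e_ n) = 0.
Proof. by move=> fn; apply: ell2P => a; rewrite restrE unitvE; case: eqP => // /fn. Qed.

Lemma extE z a : adj (restr f) z (f a) = z a.
Proof.
rewrite -[LHS]dot_unitvr (is_adjoint_sym (adjP (restr_bounded))) restr_unitv.
exact: dot_unitvr.
Qed.

Lemma ext_out z n : (forall a, f a <> n) -> adj (restr f) z n = 0.
Proof.
move=> fn; rewrite -[LHS]dot_unitvr (is_adjoint_sym (adjP (restr_bounded))) restr_unitv0//.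
by rewrite dotC dot0l conjc0.
Qed.

Lemma ext_bounded : bounded_operator (adj (restr f)).
Proof. exact: adj_bounded restr_bounded. Qed.

Lemma restrK z : restr f (adj (restr f) z) = z.
Proof. by apply: ell2P => n; rewrite restrE extE. Qed.

Lemma ext_norm z : 'N (adj (restr f) z) <= 'N z.
Proof.
rewrite -[leRHS]mul1r; apply: adj_norm => [|//|x]; first exact: restr_linear.
by rewrite mul1r restr_norm.
Qed.

End OneMap.
End Restriction.

Section Amplification.
Variable R : realType.
Local Notation H := (ell2 R).
Local Notation "''N' x" := (ell2_norm x) (at level 10).
Local Notation e_ := (@unitv R).
Implicit Types (x y z : H) (c : R[i]) (A B S T : H -> H).
Variable phi : nat -> nat -> nat.
Hypothesis phi_inj : forall m k i j, phi m i = phi k j -> m = k /\ i = j.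

Let col_inj m : injective (phi m).
Proof. by move=> i j /phi_inj[]. Qed.

Let phi2 (p : nat * nat) := phi p.1 p.2.

Let phi2_inj : injective phi2.
Proof. by move=> [m i] [k j] /phi_inj[/= -> ->]. Qed.

Definition decode (n : nat) : option (nat * nat) :=
  if pselect (exists p, phi2 p = n) is left e then Some (sval (cid e)) else None.

Lemma decode_phi m i : decode (phi m i) = Some (m, i).
Proof.
rewrite /decode; case: pselect => [e|]; last by case; exists (m, i).
by case: (cid e) => p /= /(@phi2_inj p (m, i)) ->.
Qed.

Lemma decode_out n : (forall m i, phi m i <> n) -> decode n = None.
Proof. by move=> pn; rewrite /decode; case: pselect => // e; exfalso; case: e => -[m i] /pn. Qed.

Lemma phi_cases n : (exists m i, n = phi m i) \/ (forall m i, phi m i <> n).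
Proof.
have [[m [i ->]]|h] := pselect (exists m i, n = phi m i); first by left; exists m, i.
by right => m i pn; apply: h; exists m, i.
Qed.

Lemma restr_unitv_phi m k a : restr (phi m) (e_ (phi k a)) = if m == k then e_ a else 0.
Proof.
case: eqP => [->|mk]; first exact: restr_unitv.
by apply: restr_unitv0 => // b /phi_inj[].
Qed.

Definition amp_seq T x (n : nat) : R[i] :=
  if decode n is Some (m, i) then T (restr (phi m) x) i else 0.

Fact amp_key : unit. Proof. exact: tt. Qed.
(* Under the identification of the span of the vectors [e_(phi m i)] with
   [ell2 (x) ell2], the second factor being indexed by [m], this is [T (x) 1]. *)
Definition amp : (H -> H) -> H -> H :=
  locked_with amp_key (fun T x => to_ell2 (amp_seq T x)).

(** The sum of squares is taken column by column: each column of [x] is enlarged at most by the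
    factor [M], and the columns together carry at most the squared norm of [x]. *)
Lemma amp_sqsum T M x n : linear T -> 0 <= M -> (forall x, 'N (T x) <= M * 'N x) ->
  sqsum (amp_seq T x) n <= (M * 'N x) ^+ 2.
Proof.
move=> Tlin M0 TM; rewrite -lee_fin; apply: le_trans (esum_sqsum _ _) _.
(* Absorbing [M] into the vector avoids scaling extended sums. *)
pose Mx := M%:C *: x.
have <- : 'N Mx = M * 'N x by rewrite ell2_normZ normcC ger0_norm.
rewrite (esum_supp phi2_inj); last first.
  by move=> k pk; rewrite /amp_seq decode_out// => m i; exact: (pk (m, i)).
pose X := ([set: nat] `*`` (fun=> [set: nat])).
have -> : [set: nat * nat] = X by apply/seteqP; split.
have E : (\esum_(p in X) esq (amp_seq T x) (phi2 p) =
    \esum_(m in [set: nat]) \esum_(i in [set: nat]) esq (T (restr (phi m) x)) i)%E.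
  rewrite esum_esum; last by move=> *; exact: esq_ge0.
  by apply: eq_esum => -[m i] _; rewrite /esq /amp_seq decode_phi.
rewrite E.
apply: (@le_trans _ _ (\esum_(m in [set: nat])
    \esum_(i in [set: nat]) esq (restr (phi m) Mx) i)%E).
  apply: le_esum => m _; rewrite !esum_ell2 lee_fin ler_pXn2r ?nnegrE ?ell2_norm_ge0//.
  apply: le_trans (TM _) _; rewrite /Mx (linZ (restr_linear (@col_inj m))) ell2_normZ.
  by rewrite normcC ger0_norm.
rewrite esum_esum; last by move=> *; exact: esq_ge0.
rewrite -esum_ell2; apply: le_trans (esum_inj_le Mx phi2_inj).
rewrite -/X; have <- : [set: nat * nat] = X by apply/seteqP; split.
by apply: le_esum => -[m i] _; rewrite /esq restrE.
Qed.

Lemma ampE T x n : bounded_operator T -> amp T x n = amp_seq T x n.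
Proof.
move=> /bounded_operatorP[lT [M M0 MP]]; rewrite /amp unlock.
by apply/to_ell2E/square_summable_bound => k; exact: (amp_sqsum _ _ lT M0 MP).
Qed.

Lemma amp_norm T M x : linear T -> 0 <= M -> (forall x, 'N (T x) <= M * 'N x) ->
  'N (amp T x) <= M * 'N x.
Proof.
move=> lT M0 MP; apply: norm_sqsum_le => [n|]; last by rewrite mulr_ge0 ?ell2_norm_ge0.
rewrite (_ : ell2_val _ = amp_seq T x); first exact: amp_sqsum.
by apply/funext => k; apply: ampE; apply/bounded_operatorP; split=> //; exists M.
Qed.

Lemma amp_coord T x m i : bounded_operator T -> amp T x (phi m i) = T (restr (phi m) x) i.
Proof. by move=> bT; rewrite ampE// /amp_seq decode_phi. Qed.

Lemma amp_out T x n : bounded_operator T -> (forall m i, phi m i <> n) -> amp T x n = 0.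
Proof. by move=> bT pn; rewrite ampE// /amp_seq decode_out. Qed.

Lemma restr_amp T x m : bounded_operator T -> restr (phi m) (amp T x) = T (restr (phi m) x).
Proof. by move=> bT; apply: ell2P => i; rewrite restrE// amp_coord. Qed.

(** With this, the algebraic identities for [amp] are checked one column at a time. *)
Lemma amp_ext (f : H -> H) T : bounded_operator T ->
  (forall x m, restr (phi m) (f x) = T (restr (phi m) x)) ->
  (forall x n, (forall m i, phi m i <> n) -> f x n = 0) -> f = amp T.
Proof.
move=> bT fc f0; apply/funext => x; apply: ell2P => n.
have [[m [i ->]]|nn] := phi_cases n; last by rewrite amp_out ?f0.
by rewrite amp_coord// -fc restrE.
Qed.

Lemma amp_bounded T : bounded_operator T -> bounded_operator (amp T).
Proof.
move=> bT; have lT := bounded_operator_linear bT; apply/bounded_operatorP; split.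
  move=> c x y; apply: ell2P => n; rewrite [RHS]ell2DE [X in _ = X + _]ell2ZE.
  have [[m [i ->]]|nn] := phi_cases n; last by rewrite !amp_out// mulr0 addr0.
  by rewrite !amp_coord// (restr_linear (@col_inj m)) lT.
have /bounded_operatorP[_ [M M0 MP]] := bT; exists M => // x; exact: amp_norm.
Qed.

(** The operator is recovered by compressing its amplification to column 0. *)
Lemma amp_inj S T : bounded_operator S -> bounded_operator T -> amp S = amp T -> S = T.
Proof.
move=> bS bT ST; apply/funext => x; pose y := adj (restr (phi 0%N)) x.
by have := restr_amp y 0%N bS; rewrite ST restr_amp// restrK.
Qed.

Lemma amp_lin c S T : bounded_operator S -> bounded_operator T ->
  amp (c *: S + T) = c *: amp S + amp T.
Proof.
move=> bS bT; apply/esym/amp_ext => [|x m|x n nn]; first exact: bounded_operator_lin.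
  rewrite -[(c *: amp S + amp T) x]/(c *: amp S x + amp T x) (restr_linear (@col_inj m)).
  by rewrite !restr_amp.
rewrite -[(c *: amp S + amp T) x]/(c *: amp S x + amp T x) ell2DE ell2ZE !amp_out//.
by rewrite mulr0 addr0.
Qed.

Lemma amp_comp S T : bounded_operator S -> bounded_operator T ->
  amp (S \o T) = amp S \o amp T.
Proof.
move=> bS bT; apply/esym/amp_ext => [|x m|x n nn]; first exact: bounded_operator_comp.
  by rewrite /= !restr_amp.
by rewrite /= amp_out.
Qed.

(** Every column receives a copy of the same vector [T (e_ a)]; the separation argument rests on
    this. *)
Lemma amp_unitv T m a : bounded_operator T ->
  amp T (e_ (phi m a)) = adj (restr (phi m)) (T (e_ a)).
Proof.
move=> bT; apply: ell2P => n; have [[k [i ->]]|nn] := phi_cases n; last first.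
  by rewrite amp_out// ext_out.
rewrite amp_coord// restr_unitv_phi; case: eqP => [->|km]; first by rewrite extE.
rewrite (lin0 (bounded_operator_linear bT)) ext_out// => b /phi_inj[mk].
by rewrite mk in km.
Qed.

Lemma amp_adj T : bounded_operator T -> is_adjoint (amp T) (amp (adj T)).
Proof.
move=> bT; have bS := adj_bounded bT; have aT := adjP bT.
apply: is_adjoint_basis => [||a b]; try exact: amp_bounded.
have out A l n : bounded_operator A -> (forall m i, phi m i <> l) -> amp A (e_ l) n = 0.
  move=> bA nc; have [[m [i ->]]|nn] := phi_cases n; last by rewrite amp_out.
  rewrite amp_coord// restr_unitv0 ?(lin0 (bounded_operator_linear bA))//; exact: nc.
have [[m [i ->]]|na] := phi_cases a; last by rewrite out// amp_out// conjc0.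
have [[k [j ->]]|nb] := phi_cases b; last by rewrite amp_out// out// conjc0.
rewrite !amp_coord// !restr_unitv_phi eq_sym; case: eqP => _; last first.
  by rewrite (lin0 (bounded_operator_linear bS)) (lin0 (bounded_operator_linear bT)) conjc0.
by rewrite -[LHS]dot_unitvr aT dot_unitvl.
Qed.

Definition amp_algebra : set (H -> H) := [set amp T | T in @compact_operator R].

Lemma amp_algebra_cstar : cstar_subalgebra amp_algebra.
Proof.
split.
- by move=> _ [T [bT _] <-]; exact: amp_bounded.
- exists (0 : H -> H); first exact: compact_operator0.
  apply/esym/amp_ext => [|x m|x n nn //]; first exact: bounded_operator0.
  by rewrite (lin0 (restr_linear (@col_inj m))).
- move=> c _ _ [S cS <-] [T cT <-]; exists (c *: S + T); first exact: compact_lin.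
  by apply: amp_lin; exact: compact_operator_bounded.
- move=> _ _ [S cS <-] [T cT <-]; exists (S \o T).
    by apply: compact_compr => //; exact: compact_operator_bounded.
  by apply: amp_comp; exact: compact_operator_bounded.
- move=> _ [T cT <-]; exists (amp (adj T)); last by apply: amp_adj; exact: compact_operator_bounded.
  by exists (adj T) => //; exact: compact_adj.
(* Norm closedness: the candidate [T] is the compression of [B] to column 0. Compression and [amp]
   do not increase norms, so an [S] with [amp S] close to [B] is close to [T], and [amp T] is close
   to [B]. *)
move=> B bB BA; pose r : H -> H := restr (phi 0%N); pose v := adj r.
pose T : H -> H := r \o B \o v.
have bT : bounded_operator T.
  rewrite /T /v /r; apply: bounded_operator_comp _ (ext_bounded _ (@col_inj 0%N)).
  by apply: bounded_operator_comp _ bB; exact: restr_bounded.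
have BA' e : 0 < e -> exists2 S, compact_operator S & forall x, 'N (B x - amp S x) <= e * 'N x.
  move=> e0; have [|_ [S cS <-] SP] := BA e%:C; first by rewrite ltcR.
  exists S => // x; have := SP x.
  by rewrite !ell2_normE -rmorphM/= lecR.
have TS e S : bounded_operator S -> (forall x, 'N (B x - amp S x) <= e * 'N x) -> 0 < e ->
    forall x, 'N (T x - S x) <= e * 'N x.
  move=> bS SP e0 x; have -> : S x = r (amp S (v x)) by rewrite /r restr_amp// restrK.
  rewrite -(linB (restr_linear (@col_inj 0%N))) (le_trans (restr_norm _ _))//.
  by rewrite (le_trans (SP _))// ler_wpM2l ?(ltW e0)// ext_norm.
exists T.
  apply: compact_limit => // e e0; have [S cS SP] := BA' e e0.
  by exists S => //; apply: TS => //; exact: compact_operator_bounded.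
apply/funext => x; apply/eqP; rewrite -subr_eq0; apply/eqP.
apply: (@norm_le_eps _ _ ('N x)) => e e0; have e20 : 0 < e / 2 by rewrite divr_gt0.
have [S cS SP] := BA' _ e20; have bS := compact_operator_bounded cS.
have -> : amp T x - B x = amp (T - S) x - (B x - amp S x).
  have -> : T - S = (-1) *: S + T by rewrite scaleN1r addrC.
  rewrite amp_lin// -[(_ + amp T) x]/(-1 *: amp S x + amp T x) scaleN1r.
  by rewrite opprB [- _ + amp T x]addrC addrA subrK.
apply: le_trans (ell2_normB _ _) _; rewrite (splitr e) mulrDl; apply: lerD; last exact: SP.
apply: amp_norm (ltW e20) _; first exact: bounded_operator_linear (bounded_operator_sub bT bS).
exact: TS.
Qed.

Lemma amp_algebra_iso : star_isomorphic amp_algebra compact_operator.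
Proof.
pose P A := [set T | compact_operator T /\ amp T = A].
(* [Phi] inverts [amp] on the algebra, by [amp_inj]; elsewhere it takes the default value 0. *)
pose Phi A := xget (0 : H -> H) (P A).
have PhiE T : compact_operator T -> Phi (amp T) = T.
  move=> cT; rewrite /Phi; case: xgetP => [S _ [cS /amp_inj]|/(_ T)[]//].
  by apply; exact: compact_operator_bounded.
exists Phi; split.
- split.
  + by move=> _ [T cT <-]; rewrite PhiE.
  + by move=> A B; rewrite !inE => -[S cS <-] [T cT <-]; rewrite !PhiE// => ->.
  + by move=> T cT; exists (amp T); rewrite ?PhiE//; exists T.
- move=> c _ _ [S cS <-] [T cT <-]; rewrite -amp_lin ?PhiE//; try exact: compact_operator_bounded.
  exact: compact_lin.
- move=> _ _ [S cS <-] [T cT <-]; rewrite -amp_comp ?PhiE//; try exact: compact_operator_bounded.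
  by apply: compact_compr => //; exact: compact_operator_bounded.
move=> _ _ [S cS <-] [T cT <-] ST; rewrite !PhiE//.
have bS := compact_operator_bounded cS; suff -> : T = adj S by exact: adjP.
apply: amp_inj; [exact: compact_operator_bounded|exact: adj_bounded|].
exact: is_adjoint_uniq ST (amp_adj bS).
Qed.

End Amplification.

Section AlmostOrthogonal.
Variable R : realType.
Local Notation H := (ell2 R).
Implicit Types (S T : H -> H).

(** Only the columns of [phi] before [N] can meet the range of [amp psi T], so the product is a sum
    of [N] operators, each of which factors through the compact [S]. *)
Lemma amp_almost_orthogonal (phi psi : nat -> nat -> nat) N :
  (forall m k i j, phi m i = phi k j -> m = k /\ i = j) ->
  (forall m k i j, psi m i = psi k j -> m = k /\ i = j) ->
  (forall m k i j, (N <= m)%N -> phi m i <> psi k j) ->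
  forall S T, compact_operator S -> bounded_operator T ->
    compact_operator (amp phi S \o amp psi T : H -> H).
Proof.
move=> phiI psiI disj S T cS bT; have bS := compact_operator_bounded cS.
have colI m : injective (phi m) by move=> i j /phiI[].
pose part m := adj (restr (phi m)) \o (S \o (restr (phi m) \o amp psi T)) : H -> H.
have cpart m : compact_operator (part m).
  apply: compact_compl _ (ext_bounded _ (colI m)); apply: compact_compr => //.
  by apply: bounded_operator_comp; [exact: restr_bounded|exact: amp_bounded].
have csum n : compact_operator (\sum_(m < n) part m).
  elim: n => [|n IH]; first by rewrite big_ord0; exact: compact_operator0.
  by rewrite big_ord_recr/= -[X in X + _]scale1r; exact: compact_lin.
suff -> : amp phi S \o amp psi T = \sum_(m < N) part m by [].
have sumE (f : 'I_N -> H -> H) x n : (\sum_m f m) x n = \sum_m f m x n.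
  by elim/big_rec2: _ => // i u v _ <-.
apply/esym/funext => x; apply: ell2P => n; rewrite sumE /=.
have [[k [i ->]]|nn] := phi_cases phi n; last first.
  rewrite amp_out// big1// => m _; rewrite /part/= ext_out//; exact: nn.
rewrite amp_coord//.
have part0 m : m != k -> part m x (phi k i) = 0.
  by move=> /eqP mk; rewrite /part/= ext_out// => a /phiI[].
have [kN|Nk] := ltnP k N.
  rewrite (bigD1 (Ordinal kN))//= [X in _ + X]big1 ?addr0 => [|m mk]; last exact: part0.
  by rewrite /part/= extE.
have -> : restr (phi k) (amp psi T x) = 0.
  by apply: ell2P => j; rewrite restrE// amp_out// => l b /esym; exact: disj.
rewrite (lin0 (bounded_operator_linear bS)) big1// => m _; apply: part0.
by rewrite neq_ltn (leq_trans (ltn_ord m) Nk).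
Qed.

End AlmostOrthogonal.

(** * The Luzin argument *)

Lemma uncountable_fiber (T : Type) (C : countType) (X : set T) (f : T -> C) :
  ~ countable X -> exists c, ~ countable [set x | X x /\ f x = c].
Proof.
move=> Xunc; apply: contrapT => nc; apply: Xunc.
have -> : X = \bigcup_(c in [set: C]) [set x | X x /\ f x = c].
  by apply/seteqP; split=> [x Xx|x [c _ []]]; first by exists (f x).
apply: bigcup_countable => // c _; apply: contrapT => h; by apply: nc; exists c.
Qed.

Section Separation.
Variables (d : Order.disp_t) (W : orderType d).
Hypothesis Womega1 : is_omega1 W.

(** The points that fail to lie above a given sequence in [Y] form a countable union of countable
    segments and singletons, which cannot cover [X]. *)
Lemma infinite_below (X Y : set W) : ~ countable X -> ~ countable Y ->
  exists2 a, X a & infinite_set [set b | Y b /\ (b < a)%O].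
Proof.
move=> Xunc Yunc.
have Yinf : infinite_set Y by move=> /finite_set_countable.
have [b binj bY] : exists2 b : nat -> W, injective b & forall n, Y (b n).
  have /infiniteP/card_leP[f] := Yinf.
  exists (fun n => \val (f (to_setT n))) => [m n /val_inj|n]; last exact: set_valP.
  by move=> /(@inj _ _ _ f) => /(_ (in_setT _) (in_setT _))[].
have [a [Xa ab]] : exists a, X a /\ forall n, (b n < a)%O.
  apply: contrapT => na; apply: Xunc.
  have Xsub : X `<=` \bigcup_(n in [set: nat]) ([set` `]-oo, b n[] `|` [set b n]).
    move=> x Xx; apply: contrapT => nx; apply: na; exists x; split=> // n.
    rewrite ltNge le_eqVlt; apply/negP => /orP[/eqP xb|xb]; apply: nx; exists n => //.
      by right.
    by left; rewrite /= in_itv.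
  apply: sub_countable (subset_card_le Xsub) _; apply: bigcup_countable => // n _.
  rewrite -bigcup2E; apply: bigcup_countable => // i _; rewrite /bigcup2.
  case: ifP => _; first exact: omega1_segment.
  by case: ifP => _; [exact: countable1|exact: countable0].
exists a => // fin.
have : finite_set (b @` [set: nat]).
  by apply: sub_finite_set fin => _ [n _ <-]; split.
rewrite (eq_finite_set (@inj_card_eq _ _ _ b _)); first exact: infinite_nat.
by move=> m n _ _ /binj.
Qed.

Variables (R : realType) (phi : W -> nat -> nat -> nat).
Local Notation H := (ell2 R).
Local Notation "''N' x" := (ell2_norm x) (at level 10).
Local Notation e_ := (@unitv R).
Hypothesis phi_inj : forall a m k i j, phi a m i = phi a k j -> m = k /\ i = j.
Hypothesis phi_ge : forall a m i, (m <= phi a m i)%N.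

Let col_inj a m : injective (phi a m).
Proof. by move=> i j /phi_inj[]. Qed.

(** If [A] amplifies [T], some [T (e_ c)] is nonzero. The witness consists of this vector, the row
    [c] and a coordinate where the vector does not vanish. *)
Lemma amp_algebra_column a (A : H -> H) : amp_algebra (phi a) A -> A <> 0 ->
  exists z : H * (nat * nat),
    (forall m, A (e_ (phi a m z.2.1)) = adj (restr (phi a m)) z.1) /\ z.1 z.2.2 <> 0.
Proof.
move=> [T cT <-] A0; have bT := compact_operator_bounded cT.
apply: contrapT => nex; apply: A0.
have Te c : T (e_ c) = 0.
  apply: ell2P => i; apply: contrapT => Ti; apply: nex; exists (T (e_ c), (c, i)).
  by split=> // m; exact: (amp_unitv (@phi_inj a)).
have T0 : T = 0 by apply: bounded_operator_ext => //; exact: bounded_operator0.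
apply/esym/(amp_ext (@phi_inj a)) => // x m.
by rewrite T0 (lin0 (restr_linear (@col_inj a m))).
Qed.

(* The last two components bound the vector from below at the coordinate
   [i] and from above in norm. *)
Definition tame (z : H * (nat * nat)) (k : nat * (nat * nat)) : Prop :=
  [/\ z.2.2 = k.1, k.2.1.+1%:R^-1 <= normc (z.1 z.2.2) & 'N z.1 <= k.2.2%:R].

Lemma tame_ex (z : H * (nat * nat)) : z.1 z.2.2 <> 0 -> exists k, tame z k.
Proof.
case: z => v [a i] /= vi; have v0 : 0 < normc (v i).
  by rewrite lt0r normc_ge0 andbT; apply/eqP => /Normc.eq0_normc.
have [q qP] := @ltr_add_invr R 0 _ v0.
exists (i, (q, (Num.truncn ('N v)).+1)); split=> //=.
  by apply: ltW; rewrite add0r in qP.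
by apply: ltW; exact: truncnS_gt.
Qed.

(** Row and vector may vary with [a]; only the coordinate and the two bounds, which range over a
    countable type, are made constant by pigeonhole. *)
Lemma uncountable_tame (X : set W) (A : W -> (H -> H)) : ~ countable X ->
  (forall a, X a -> amp_algebra (phi a) (A a) /\ A a <> 0) ->
  exists z k, ~ countable [set a | X a /\ tame (z a) k /\
    forall m, A a (e_ (phi a m (z a).2.1)) = adj (restr (phi a m)) (z a).1].
Proof.
move=> Xu XA.
have zex a : exists z : H * (nat * nat), X a ->
    (forall m, A a (e_ (phi a m z.2.1)) = adj (restr (phi a m)) z.1) /\ z.1 z.2.2 <> 0.
  have [Xa|nXa] := pselect (X a); last by exists (0, (0, 0)%N).
  by have [Fa Aa] := XA a Xa; have [z zP] := amp_algebra_column Fa Aa; exists z.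
have [z zP] := choice zex.
have kex a : exists k, X a -> tame (z a) k.
  have [Xa|nXa] := pselect (X a); last by exists (0, (0, 0))%N.
  by have [_ /tame_ex[k kP]] := zP a Xa; exists k.
have [k kP] := choice kex; have [k0 Xk0] := uncountable_fiber k Xu.
exists z, k0 => h; apply: Xk0; apply: sub_countable h; apply: subset_card_le.
move=> a [Xa <-]; split=> //; split; first exact: kP.
by case: (zP a Xa).
Qed.

(** Since [phi a m i] is at least [m], the vectors tested run off to infinity and [compact_unitv]
    applies; pigeonhole makes the threshold uniform. *)
Lemma uncountable_small (X : set W) (c : W -> nat) (K : W -> (H -> H)) (e : R) :
  ~ countable X -> (forall a, X a -> compact_operator (K a)) -> 0 < e ->
  exists n, ~ countable [set a | X a /\ forall m, (n <= m)%N ->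
    'N (K a (e_ (phi a m (c a)))) <= e].
Proof.
move=> Xu cK e0.
have nex a : exists n, X a -> forall m, (n <= m)%N -> 'N (K a (e_ (phi a m (c a)))) <= e.
  have [Xa|nXa] := pselect (X a); last by exists 0%N.
  have [n nP] := compact_unitv (cK a Xa) e0; exists n => _ m nm.
  by apply: nP; exact: leq_trans nm (phi_ge _ _ _).
have [n nP] := choice nex; have [n0 Xn0] := uncountable_fiber n Xu.
exists n0 => h; apply: Xn0; apply: sub_countable h; apply: subset_card_le.
by move=> a [Xa <-]; split=> //; exact: nP.
Qed.

Hypothesis phi_meet : forall a i j n, finite_set [set b | (b < a)%O /\
  ~ exists2 m, (n <= m)%N & phi a m i = phi b m j /\
    forall x y, phi a m x = phi b m y -> x = i /\ y = j].

(** The supports of the two copies have at most the one coordinate [phi a m i] in common. *)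
Lemma dot_meet a b m i j v w : phi a m i = phi b m j ->
  (forall x y, phi a m x = phi b m y -> x = i /\ y = j) ->
  ell2_dot (adj (restr (phi a m)) v) (adj (restr (phi b m)) w : H) = v i * conjc (w j).
Proof.
move=> E meet; rewrite (@dot_single _ _ _ (phi a m i)).
  by rewrite extE// E extE.
move=> n nE; have [[x nx]|nout] := pselect (exists x, phi a m x = n); last first.
  by rewrite ext_out ?mul0r// => x nx; apply: nout; exists x.
have [[y ny]|nout] := pselect (exists y, phi b m y = n); last first.
  by rewrite [X in _ * conjc X]ext_out ?conjc0 ?mulr0// => y ny; apply: nout; exists y.
have [xi _] := meet x y (etrans nx (esym ny)).
by rewrite -nx xi eqxx in nE.
Qed.

Theorem amp_not_separated (X Y : set W) (A B : W -> (H -> H)) :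
  ~ countable X -> ~ countable Y ->
  (forall a, X a -> amp_algebra (phi a) (A a) /\ A a <> 0) ->
  (forall b, Y b -> amp_algebra (phi b) (B b) /\ B b <> 0) ->
  ~ exists P, [/\ projection P, forall a, X a -> P \o A a =^K A a
    & forall b, Y b -> P \o B b =^K 0].
Proof.
move=> Xu Yu XA YB [P [[bP _ aP] PA PB]].
have [v [[i [q M]] X1u]] := uncountable_tame Xu XA.
have [w [[j [q' M']] Y1u]] := uncountable_tame Yu YB.
(* The upper bound will be [e] times [M + M'] and the lower bound is [e * D]; the summand 1 makes
   the contradiction strict and [D] positive. *)
pose D : R := M%:R + M'%:R + 1.
have D0 : 0 < D by rewrite /D ltr_wpDl// addr_ge0.
pose e := q.+1%:R^-1 * q'.+1%:R^-1 / D : R.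
have e0 : 0 < e by rewrite !mulr_gt0 ?invr_gt0.
have [|n X2u] := @uncountable_small _ (fun a => (v a).2.1) (fun a => P \o A a - A a) e X1u _ e0.
  by move=> a [Xa _]; exact: PA.
have [|n' Y2u] := @uncountable_small _ (fun a => (w a).2.1) (fun a => P \o B a - 0) e Y1u _ e0.
  by move=> a [Ya _]; exact: PB.
have [a [[Xa [[/= ia va vM] Av]] aP1] Yinf] := infinite_below X2u Y2u.
(* Infinitely many [b] below [a] remain in the refined family, while [phi_meet] fails for finitely
   many only. *)
have [b [[[Yb [[/= jb wb wM] Bw]] bP1] [ba [m nm [E meet]]]]] : exists b,
    ((Y b /\ tame (w b) (j, (q', M')) /\
      forall m, B b (e_ (phi b m (w b).2.1)) = adj (restr (phi b m)) (w b).1) /\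
      forall m, (n' <= m)%N -> 'N ((P \o B b - 0) (e_ (phi b m (w b).2.1))) <= e) /\
    (b < a)%O /\ exists2 m, (maxn n n' <= m)%N & phi a m i = phi b m j /\
      forall x y, phi a m x = phi b m y -> x = i /\ y = j.
  apply: contrapT => nb; apply: Yinf; apply: sub_finite_set (phi_meet a i j (maxn n n')).
  by move=> b [Yb ba]; split=> // h; apply: nb; exists b.
move: nm; rewrite geq_max => /andP[/aP1 + /bP1].
rewrite -[(P \o A a - A a) _]/(P (A a _) - A a _) -[(P \o B b - 0) _]/(P (B b _) - 0) subr0.
rewrite Av Bw; set x := adj _ _; set y := adj _ _ => Px Py.
have xy := dot_meet (v a).1 (w b).1 E meet; rewrite -/x -/y in xy.
have xM : 'N x <= M%:R by apply: le_trans vM; exact: ext_norm.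
have yM : 'N y <= M'%:R by apply: le_trans wM; exact: ext_norm.
have up : normc (ell2_dot x y) <= e * M'%:R + M%:R * e.
  (* Self-adjointness moves [P] across, so each term has one factor of norm at most [e]. *)
  have -> : ell2_dot x y = - ell2_dot (P x - x) y + ell2_dot x (P y).
    by rewrite dotBl -aP opprB subrK.
  apply: le_trans (le_normcD _ _) _; rewrite normcN; apply: lerD.
    apply: le_trans (cauchy_schwarz _ _) _.
    by apply: ler_pM => //; exact: ell2_norm_ge0.
  apply: le_trans (cauchy_schwarz _ _) _.
  by apply: ler_pM => //; exact: ell2_norm_ge0.
have low : q.+1%:R^-1 * q'.+1%:R^-1 <= normc (ell2_dot x y).
  rewrite xy Normc.normcM normc_conj -ia -jb.
  by apply: ler_pM => //; rewrite invr_ge0.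
have := le_trans low up; apply/negP; rewrite -ltNge.
have -> : q.+1%:R^-1 * q'.+1%:R^-1 = e * D by rewrite /e divfK// gt_eqF.
by rewrite -subr_gt0 [ltRHS](_ : _ = e)// /D; ring.
Qed.

End Separation.

(** The chosen operators are required to be nonzero: if all [A alpha] vanished, [P = 0] would
    separate. *)
Theorem theorem1p8 (R : realType) (d : Order.disp_t) (W : orderType d)
    (Womega1 : is_omega1 W) :
  exists F : W -> set (ell2 R -> ell2 R),
    [/\ forall alpha, cstar_subalgebra (F alpha),
        forall alpha, star_isomorphic (F alpha) compact_operator,
        forall alpha alpha', (alpha < alpha')%O ->
          forall A A', F alpha A -> F alpha' A' -> A \o A' =^K 0
      & forall X Y : set W, ~ countable X -> ~ countable Y ->
        forall A B : W -> (ell2 R -> ell2 R),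
          (forall alpha, X alpha -> F alpha (A alpha) /\ A alpha <> 0) ->
          (forall beta, Y beta -> F beta (B beta) /\ B beta <> 0) ->
          ~ exists P, [/\ projection P,
              forall alpha, X alpha -> P \o A alpha =^K A alpha
            & forall beta, Y beta -> P \o B beta =^K 0]].
Proof.
have [phi [phi_row phi_col phi_ad phi_meet]] := luzin_injections Womega1.
have phi_inj a m k i j : phi a m i = phi a k j -> m = k /\ i = j.
  by move=> E; have mk := phi_row _ _ _ _ _ _ E; subst k; have [_ /(_ _ _ E)] := phi_col a m i.
exists (fun a => amp_algebra (phi a)); split.
- by move=> a; exact: amp_algebra_cstar (phi_inj a).
- by move=> a; exact: amp_algebra_iso (phi_inj a).
- move=> a a' aa' _ _ [S cS <-] [T cT <-]; rewrite /eq_mod_compact subr0.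
  have [|N NP] := phi_ad a a'; first by move=> E; rewrite E ltxx in aa'.
  exact: amp_almost_orthogonal (phi_inj a) (phi_inj a') NP _ _ cS (compact_operator_bounded cT).
move=> X Y Xu Yu A B; apply: amp_not_separated => // a m i.
by case: (phi_col a m i).
Qed.
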